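(* Let $q\ge3$ be an integer and let $\beta\ge\beta_s(q)$. There exists $r_0>0$, depending only on $\beta$ and $q$, such that for every $0<r\le r_0$ and every $x\in\mathfrak S_{\beta,q}$, the mixing time $t^x_{\mathrm{mix}}(\epsilon)$ of the Glauber dynamics for the Curie--Weiss--Potts model on $N$ vertices restricted to $\widetilde\Omega(x,r)$ satisfies $$t^x_{\mathrm{mix}}(1/4)=O(N\log N)\qquad\text{as }N\to\infty,$$ i.e. there are constants $C>0$ and $N_0$ (independent of $N$) such that $t^x_{\mathrm{mix}}(1/4)\le C N\log N$ for all $N\ge N_0$.
   Context: $[q]=\{1,\dots,q\}$, $\Omega=[q]^N$. The Curie--Weiss--Potts model is the probability measure $\mu(\sigma)=e^{-\beta H(\sigma)}/Z(\beta)$ on $\Omega$, with $H(\sigma)=-\frac1N\sum_{u,v\in[N]}\mathbf 1_{\{\sigma(u)=\sigma(v)\}}$ (all ordered pairs) and $Z(\beta)$ the normalising constant. Spinodal inverse temperature: $\beta_s(q)=\sup\{\beta\ge0:(1+(q-1)e^{2\beta\frac{1-qx}{q-1}})^{-1}-x\ne0\ \ \forall x\in(1/q,1)\}$. Equilibrium macrostates: $\mathfrak S_{\beta,q}=\arg\min_{s\in\mathbb R^q}G_\beta(s)$ with $G_\beta(s)=\beta\|s\|_2^2-\log\big(\sum_{i=1}^q e^{2\beta s^{(i)}}\big)$. (It is known that these points lie in the probability simplex. With $\beta_c=\frac{(q-1)\log(q-1)}{q-2}$, $\hat e=(1/q,\dots,1/q)$, $s_{\beta,q}$ the largest real solution of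 $s=\frac{1-e^{-2\beta s}}{1+(q-1)e^{-2\beta s}}$, and $\mathbf T^j\check s_{\beta,q}$ the vector with $j$th coordinate $\frac{1+(q-1)s_{\beta,q}}{q}$ and all other coordinates $\frac{1-s_{\beta,q}}{q}$, one has $\mathfrak S_{\beta,q}=\{\hat e\}$ for $0<\beta<\beta_c$, $\{\hat e,\mathbf T^1\check s_{\beta,q},\dots,\mathbf T^q\check s_{\beta,q}\}$ for $\beta=\beta_c$, and $\{\mathbf T^1\check s_{\beta,q},\dots,\mathbf T^q\check s_{\beta,q}\}$ for $\beta>\beta_c$.) For $\sigma\in\Omega$, $S(\sigma)\in\mathbb R^q$ is the vector of proportions $S^{(k)}(\sigma)=\frac1N\#\{j\in[N]:\sigma(j)=k\}$, and $\widetilde\Omega(x,r)=\{\sigma\in\Omega:\|S(\sigma)-x\|_2\le r\}$. Let $\tilde\mu=\mu(\cdot\mid\widetilde\Omega(x,r))$. The restricted Glauber dynamics is the Markov chain on $\widetilde\Omega(x,r)$ with the following step from $\sigma$: choose $v\in[N]$ uniformly at random, and form $\sigma'$ from $\sigma$ by recolouring $v$ with a colour $k$ drawn from the conditional law under $\mu$ of the colour of $v$ given the colours $\sigma(w)$, $w\neq v$; move to $\sigma'$ if $\sigma'\in\widetilde\Omega(x,r)$, otherwise stay at $\sigma$. Its transition kernel is denoted $\widetilde P$; it has $\tilde\mu$ as stationary distribution. Its mixing time is $$t^x_{\mathrm{mix}}(\epsilon)=\inf\Big\{t\ge0:\max_{\sigma\in\widetilde\Omega(x,r)}\|\widetilde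 P^t(\sigma,\cdot)-\tilde\mu\|_{\mathrm{TV}}\le\epsilon\Big\}.$$ *)

(* Defs.v *)
From HB Require Import structures.
From mathcomp Require Import all_boot all_order all_algebra.
From mathcomp Require Import all_classical all_reals all_analysis.

Set Implicit Arguments.
Unset Strict Implicit.
Unset Printing Implicit Defensive.

Import Order.TTheory GRing.Theory Num.Theory.

Local Open Scope ring_scope.

Section FiniteProbability.
Context {R : realType} {T : finType}.
Implicit Types (p : T -> R) (A B : {set T}) (P : T -> T -> R).

Definition pr p A : R := \sum_(s in A) p s.

Definition cond_pr p A B : R := pr p (A :&: B) / pr p B.

Definition tv_dist p p' : R :=
  \big[Num.max/0]_(A : {set T}) `|pr p A - pr p' A|.

Fixpoint kernel_iter P (t : nat) : T -> T -> R :=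
  if t is t'.+1 then fun s u => \sum_w P s w * kernel_iter P t' w u
  else fun s u => (s == u)%:R.

(* Extended-real valued, so that the infimum is +oo when no t qualifies. *)
Definition mixing_time P p (eps : R) : \bar R :=
  ereal_inf [set t%:R%:E | t in
    [set t : nat |
      \big[Num.max/0]_(s : T) tv_dist (kernel_iter P t s) p <= eps]]%classic.

End FiniteProbability.

Section CurieWeissPotts.
Context {R : realType} (q : nat).
Implicit Types (beta r : R) (x : 'rV[R]_q).

Definition l2norm x : R := Num.sqrt (\sum_i x 0 i ^+ 2).

Definition spinodal : R :=
  sup [set beta : R | 0 <= beta /\
        forall x : R, q%:R^-1 < x < 1 ->
          (1 + (q%:R - 1) * expR (2 * beta * ((1 - q%:R * x) / (q%:R - 1))))^-1
            - x != 0]%classic.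

Definition free_energy beta x : R :=
  beta * l2norm x ^+ 2 - ln (\sum_i expR (2 * beta * x 0 i)).

Definition macrostates beta : set 'rV[R]_q :=
  [set x | forall y, free_energy beta x <= free_energy beta y]%classic.

Context {N : nat}.

Definition config : finType := {ffun 'I_N -> 'I_q}.
Implicit Types (s : config) (v : 'I_N) (k : 'I_q).

Definition hamiltonian s : R :=
  - (N%:R^-1 * \sum_(u < N) \sum_(v < N) (s u == s v)%:R).

Definition partition_fun beta : R :=
  \sum_(s : config) expR (- beta * hamiltonian s).

Definition gibbs beta s : R :=
  expR (- beta * hamiltonian s) / partition_fun beta.

Definition proportions s : 'rV[R]_q :=
  \row_(k < q) (#|[set j | s j == k]|%:R / N%:R).

Definition config_ball x r : {set config} :=
  [set s | l2norm (proportions s - x) <= r].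

Definition ball_state x r : finType := {s : config | s \in config_ball x r}.

Definition gibbs_ball beta x r (s : ball_state x r) : R :=
  cond_pr (gibbs beta) [set val s] (config_ball x r).

Definition recolor s v k : config := [ffun w => if w == v then k else s w].

Definition colour_law beta s v k : R :=
  cond_pr (gibbs beta) [set t : config | t v == k]
    [set t : config | [forall w, (w != v) ==> (t w == s w)]].

(* [insubd s t] is [t] when [t] lies in the ball, and [s] otherwise: a proposed
   move out of the ball is rejected. *)
Definition glauber beta x r (s u : ball_state x r) : R :=
  \sum_(v < N) N%:R^-1 *
    \sum_(k < q) colour_law beta (val s) v k *
      (insubd s (recolor (val s) v k) == u)%:R.

End CurieWeissPotts.

Arguments config : clear implicits.
Arguments ball_state {R} q N x r.

Definition t_mix {R : realType} (q N : nat) (beta : R) (x : 'rV[R]_q)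
    (r eps : R) : \bar R :=
  mixing_time (@glauber R q N beta x r) (@gibbs_ball R q N beta x r) eps.

(* Main.v *)
(** Writing S for the vector of proportions, the colour of v given the others
    has law softmax (2 beta S), up to the O(1/N) contribution of v itself, and a
    macrostate x is a nondegenerate fixed point of softmax: up to permutation
    x = (a, b, ..., b) with kappa = 2 beta q a b < 1.  Near x, softmax contracts
    both the total variation distance and, along zero-sum displacements, the
    Euclidean distance, with a factor arbitrarily close to kappa.

    Two restricted chains are coupled by updating the same vertex with a maximal
    coupling of the two colour laws.  When both lie well inside the ball, no
    proposal is rejected and the expected Hamming distance contracts by
    1 - (1 - kappa) / N.  To pay for the other states, add to the Hamming
    distance a multiple of N (V^2 + V'^2), where V = |S - x|^2 on each chain.
    By the drift towards x, one step multiplies the expectation of V^2 by at most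
    1 - (1 - kappa) / N, up to an error O(1 / N^3), and a rejected proposal would
    only have increased V.  The sum contracts by 1 - c / N up to an error
    O(1 / N^2), hence is O(1 / N) after O(N log N) steps. *)

Require Import Defs.
From HB Require Import structures.
From mathcomp Require Import all_boot all_order all_algebra.
From mathcomp Require Import all_classical all_reals all_analysis.
From mathcomp Require Import ring lra.

Set Implicit Arguments.
Unset Strict Implicit.
Unset Printing Implicit Defensive.

Import Order.TTheory GRing.Theory Num.Theory.
Import numFieldNormedType.Exports.

Local Open Scope ring_scope.

(** * Entropy along a line *)

(** Minimality by itself gives only [kappa <= 1]; the obstacle is the equality case, on which a
    second-order condition is silent. It is removed by passing from [free_energy] to the separable
    functional [total_ent], which a macrostate minimises among positive probability vectors. On the
    line through the macrostate that keeps the smaller coordinates equal, the second derivative is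
    [1 / (t (1 - t)) - K], whose sign is known globally, so monotonicity settles the degenerate case
    as well. Since [r0] is chosen before [x], one [kappa] must serve all macrostates; the same sign
    analysis shows that the non-uniform ones share the value [a]. Two norms occur because the
    coupling measures disagreement in total variation whereas the ball is Euclidean. To first order
    softmax acts near [x] as [2 beta] times the covariance matrix of [x], and [q a b] bounds this
    matrix in both senses, so one rate serves both. *)

Section OneVariable.
Context {R : realType}.
Implicit Types (f df : R -> R) (a b t beta m : R).

Lemma derive_lt0_lt f df a b : a < b ->
  (forall t, a <= t <= b -> is_derive t 1 f (df t)) ->
  (forall t, a < t < b -> df t < 0) -> f b < f a.
Proof.
move=> ab fdf df0.
have [||c cab fE] := @MVT R f df a b ab.
- by move=> t; rewrite in_itv /= => /andP[at_ tb]; apply: fdf; rewrite !ltW.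
- apply: derivable_within_continuous => t; rewrite in_itv /= => tab.
  by have [] := fdf t tab.
rewrite -subr_lt0 fE pmulr_llt0 ?subr_gt0//.
by apply: df0; rewrite in_itv /= in cab.
Qed.

Lemma derive_gt0_lt f df a b : a < b ->
  (forall t, a <= t <= b -> is_derive t 1 f (df t)) ->
  (forall t, a < t < b -> 0 < df t) -> f a < f b.
Proof.
move=> ab fdf df0.
suff : (\- f) b < (\- f) a by rewrite /= ltrN2.
apply: (@derive_lt0_lt (\- f) (\- df)) => // t tab.
- by have := fdf t tab => ?; apply: is_deriveN.
- by rewrite /= oppr_lt0 df0.
Qed.

Lemma ln_lt_subr1 t : 0 < t -> t != 1 -> ln t < t - 1.
Proof.
move=> t0 t1; rewrite -ltr_expR lnK//.
have := @expR_gt1Dx R (t - 1); rewrite subr_eq0 => /(_ t1).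
by rewrite addrC subrK.
Qed.

Lemma ln_le_subr1 t : 0 < t -> ln t <= t - 1.
Proof.
by move=> t0; have [->|/(ln_lt_subr1 t0)/ltW//] := eqVneq t 1; rewrite ln1 subrr.
Qed.

(** One coordinate's share of minus the entropy minus [beta] times the squared norm, the functional
    dual to [free_energy]. *)
Definition ent beta t := t * ln t - beta * t ^+ 2.

Lemma is_derive_ent beta t : 0 < t ->
  is_derive t 1 (ent beta) (ln t + 1 - 2 * beta * t).
Proof.
move=> t0; have Dln := is_derive1_ln t0.
apply: is_derive_eq.
by rewrite /= /GRing.scale /=; field; rewrite gt_eqF.
Qed.

(** [total_ent] along the vectors of sum 1 with one coordinate [t] and [m] equal others; [m] will be
    [q - 1]. *)
Definition line_ent beta m t := ent beta t + m * ent beta ((1 - t) / m).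

Definition line_slope beta m t :=
  ln t - ln ((1 - t) / m) - 2 * beta * (t - (1 - t) / m).

Lemma is_derive_line_ent beta m t : 0 < m -> 0 < t < 1 ->
  is_derive t 1 (line_ent beta m) (line_slope beta m t).
Proof.
move=> m0 /andP[t0 t1].
have u0 : 0 < (1 - t) / m by rewrite divr_gt0// subr_gt0.
have D1 := is_derive_ent beta t0.
have D2 := is_derive_ent beta u0.
have D3 : is_derive t (1 : R) (fun s : R => (1 - s) / m) (- m^-1).
  by apply: is_derive_eq; rewrite /= /GRing.scale /=; ring.
have D4 := @is_derive1_comp R (ent beta) (fun s : R => (1 - s) / m) t _ _ D2 D3.
rewrite /line_ent.
apply: is_derive_eq.
rewrite /= /GRing.scale /= /line_slope.
by field; rewrite gt_eqF.
Qed.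

Lemma is_derive_line_slope beta m t : 0 < m -> 0 < t < 1 ->
  is_derive t 1 (line_slope beta m)
    ((t * (1 - t))^-1 - 2 * beta * ((m + 1) / m)).
Proof.
move=> m0 /andP[t0 t1].
have u0 : 0 < (1 - t) / m by rewrite divr_gt0// subr_gt0.
have D1 := is_derive1_ln t0.
have D2 := is_derive1_ln u0.
have D3 : is_derive t (1 : R) (fun s : R => (1 - s) / m) (- m^-1).
  by apply: is_derive_eq; rewrite /= /GRing.scale /=; ring.
have D4 := @is_derive1_comp R (@ln R) (fun s : R => (1 - s) / m) t _ _ D2 D3.
rewrite /line_slope.
apply: is_derive_eq.
rewrite /= /GRing.scale /=.
by field; rewrite !gt_eqF ?subr_gt0.
Qed.

Lemma ln_gt_ratio m : 1 < m -> 2 * ((m - 1) / (m + 1)) < ln m.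
Proof.
move=> m1.
pose h (t : R) := ln t - 2 * ((t - 1) / (t + 1)).
suff : h 1 < h m by rewrite /h ln1 subrr mul0r mulr0 subr0 subr_gt0.
apply: (@derive_gt0_lt h (fun t => (t - 1) ^+ 2 / (t * (t + 1) ^+ 2))) => //.
- move=> t /andP[t1 _].
  have t0 : 0 < t by lra.
  have t10 : t + 1 != 0 by rewrite gt_eqF//; lra.
  have D1 := is_derive1_ln t0.
  have D2 : is_derive t (1 : R) (fun s : R => (s + 1)^-1) (- (t + 1) ^- 2).
    by apply: is_derive_eq; rewrite /= /GRing.scale /= addr0 mulr1.
  rewrite /h; apply: is_derive_eq.
  rewrite /= /GRing.scale /=.
  by field; rewrite t10 gt_eqF.
- by move=> t /andP[t1 _]; rewrite divr_gt0 ?mulr_gt0 ?exprn_gt0//; lra.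
Qed.

(* [line_slope] has derivative [1 / (t (1 - t)) - K], negative strictly between
   [a] and [1 - a] when [1 <= K a (1 - a)]; so at a zero of the slope the entropy
   strictly decreases towards [1/2].  If [a = 1/2] one uses [K > 4], and [K = 4]
   is excluded by [ln_gt_ratio]. *)
Lemma line_ent_not_min beta m a : 1 < m -> 0 < a < 1 ->
  line_slope beta m a = 0 ->
  1 <= 2 * beta * ((m + 1) / m) * (a * (1 - a)) ->
  exists2 t : R, 0 < t < 1 & line_ent beta m t < line_ent beta m a.
Proof.
move=> m1 /andP[a0 a1] La Ka.
have m0 : 0 < m by lra.
set K := 2 * beta * ((m + 1) / m) in Ka *.
have K0 : 0 < K.
  have aa : 0 < a * (1 - a) by rewrite mulr_gt0 ?subr_gt0.
  by rewrite -(pmulr_lgt0 _ aa); lra.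
have right_case (b : R) : a < b < 1 ->
    (forall t : R, a < t < b -> 1 < K * (t * (1 - t))) ->
    exists2 t : R, 0 < t < 1 & line_ent beta m t < line_ent beta m a.
  move=> /andP[ab b1] Kt; exists b; first by rewrite b1 andbT; lra.
  apply: (@derive_lt0_lt _ (line_slope beta m)) => //.
    by move=> t /andP[at_ tb]; apply: is_derive_line_ent => //; lra.
  move=> t /andP[at_ tb]; rewrite -La.
  apply: (@derive_lt0_lt _ (fun t => (t * (1 - t))^-1 - K)) => //.
    by move=> s /andP[as_ st]; apply: is_derive_line_slope => //; lra.
  move=> s /andP[as_ st]; rewrite subr_lt0.
  have s0 : 0 < s * (1 - s) by rewrite mulr_gt0; lra.
  by rewrite -div1r ltr_pdivrMr// Kt//; lra.
have left_case (b : R) : 0 < b < a ->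
    (forall t : R, b < t < a -> 1 < K * (t * (1 - t))) ->
    exists2 t : R, 0 < t < 1 & line_ent beta m t < line_ent beta m a.
  move=> /andP[b0 ba] Kt; exists b; first by lra.
  apply: (@derive_gt0_lt _ (line_slope beta m)) => //.
    by move=> t /andP[at_ tb]; apply: is_derive_line_ent => //; lra.
  move=> t /andP[at_ tb]; rewrite -La.
  apply: (@derive_lt0_lt _ (fun t => (t * (1 - t))^-1 - K)) => //.
    by move=> s /andP[as_ st]; apply: is_derive_line_slope => //; lra.
  move=> s /andP[as_ st]; rewrite subr_lt0.
  have s0 : 0 < s * (1 - s) by rewrite mulr_gt0; lra.
  by rewrite -div1r ltr_pdivrMr// Kt//; lra.
have grow (t : R) : 0 < (t - a) * (1 - a - t) -> 1 < K * (t * (1 - t)).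
  move=> ta; apply: le_lt_trans Ka _; rewrite ltr_pM2l//; rewrite -subr_gt0.
  by have -> : t * (1 - t) - a * (1 - a) = (t - a) * (1 - a - t) by ring.
have [alt|agt|aeq] := ltgtP a (1 / 2).
- apply: (right_case (1 - a)) => [|t /andP[t1 t2]]; first lra.
  by apply: grow; rewrite mulr_gt0// subr_gt0.
- apply: (left_case (1 - a)) => [|t /andP[t1 t2]].
    by apply/andP; split; [rewrite subr_gt0|lra].
  by apply: grow; rewrite nmulr_rgt0// subr_lt0.
have K4 : 4 < K.
  have lnm : ln m = beta * ((m - 1) / m).
    move: La; rewrite /line_slope aeq.
    have -> : 1 - 1 / 2 = 1 / 2 :> R by lra.
    rewrite [X in _ - X - _]ln_div; [|by rewrite posrE; lra|by rewrite posrE].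
    move=> h; have -> : ln m = 2 * beta * (1 / 2 - 1 / 2 / m) by lra.
    by field; rewrite gt_eqF.
  have := ln_gt_ratio m1; rewrite lnm => h.
  have : (m - 1) * (2 / (m + 1)) < (m - 1) * (beta / m).
    by move: h; congr (_ < _); field; rewrite ?gt_eqF//; lra.
  rewrite ltr_pM2l; last lra.
  rewrite ltr_pdivrMr; last lra.
  by rewrite /K; have -> : 2 * beta * ((m + 1) / m) = 2 * (beta / m * (m + 1)); [ring|lra].
have Ki : 1 / K < 1 / 4 by rewrite ltr_pdivrMr//; lra.
have Ki0 : 0 < 1 / K by rewrite divr_gt0.
(* As [t (1 - t) = 1/4 - (t - 1/2)^2], what is needed is [(t - 1/2)^2 < 1/4 - 1/K]. Up to distance
   [1/4 - 1/K] from [1/2] this holds because that number is less than 1. *)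
apply: (right_case (1 / 2 + (1 / 4 - 1 / K))) => [|t /andP[t1 t2]]; first lra.
rewrite mulrC -ltr_pdivrMr//.
have : (t - 1 / 2) * (t - 1 / 2) < (1 / 4 - 1 / K) * 1 by rewrite ltr_pM//; lra.
by lra.
Qed.

End OneVariable.

(** * Macrostates *)

Section Macrostates.
Context {R : realType} (q : nat).
Implicit Types (x y z : 'I_q -> R) (beta : R).

Definition softmax beta z (k : 'I_q) : R :=
  expR (2 * beta * z k) / \sum_j expR (2 * beta * z j).

Lemma sum_expR_gt0 beta z (k : 'I_q) : 0 < \sum_j expR (2 * beta * z j).
Proof.
rewrite (bigD1 k)//= ltr_pwDl ?expR_gt0//.
by apply: sumr_ge0 => j _; apply: expR_ge0.
Qed.

Lemma softmax_gt0 beta z k : 0 < softmax beta z k.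
Proof. by rewrite divr_gt0 ?expR_gt0// (sum_expR_gt0 _ _ k). Qed.

Lemma softmax_sum beta z : (0 < q)%N -> \sum_k softmax beta z k = 1.
Proof.
move=> q0; rewrite -mulr_suml mulfV// gt_eqF//.
exact: (sum_expR_gt0 _ _ (Ordinal q0)).
Qed.

Lemma ln_softmax beta z k :
  ln (softmax beta z k) = 2 * beta * z k - ln (\sum_j expR (2 * beta * z j)).
Proof. by rewrite ln_div ?posrE ?expR_gt0 ?(sum_expR_gt0 _ _ k)// expRK. Qed.

Definition free_en beta z : R :=
  beta * (\sum_i z i ^+ 2) - ln (\sum_i expR (2 * beta * z i)).

Lemma free_energyE beta (x : 'rV[R]_q) :
  free_energy beta x = free_en beta (x 0).
Proof.
by rewrite /free_energy /l2norm sqr_sqrtr//; apply: sumr_ge0 => i _; apply: sqr_ge0.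
Qed.

Definition total_ent beta y := \sum_i ent beta (y i).

(** The gap between the two sides is the relative entropy of [y] with respect to [softmax beta y],
    nonnegative by [ln t <= t - 1]. *)
Lemma free_en_le_ent beta y : (0 < q)%N -> (forall i, 0 < y i) ->
  \sum_i y i = 1 -> free_en beta y <= total_ent beta y.
Proof.
move=> q0 y0 y1; set Z := \sum_i expR (2 * beta * y i).
have key : \sum_i y i * (2 * beta * y i - ln Z - ln (y i)) <= 0.
  apply: (@le_trans _ _ (\sum_i (softmax beta y i - y i))); last first.
    by rewrite sumrB softmax_sum// y1 subrr.
  apply: ler_sum => i _; rewrite -ln_softmax -ln_div ?posrE ?softmax_gt0//.
  have h := @ln_le_subr1 R (softmax beta y i / y i) (divr_gt0 (softmax_gt0 _ _ _) (y0 i)).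
  rewrite -(ler_pM2l (y0 i)) in h.
  by apply: (le_trans h); rewrite mulrBr mulr1 mulrC divfK// gt_eqF.
rewrite -subr_ge0 -oppr_le0; apply: le_trans key.
rewrite le_eqVlt; apply/orP; left; apply/eqP.
transitivity (2 * beta * (\sum_i y i ^+ 2) - ln Z * (\sum_i y i) - \sum_i y i * ln (y i)).
  rewrite /free_en /total_ent /ent sumrB -mulr_sumr y1 -/Z.
  by ring.
rewrite !mulr_sumr -!sumrB; apply: eq_bigr => i _; ring.
Qed.

Lemma free_en_softmax beta z : (0 < q)%N ->
  free_en beta z = beta * (\sum_i (z i - softmax beta z i) ^+ 2)
    + total_ent beta (softmax beta z).
Proof.
move=> q0; set p := softmax beta z; set Z := \sum_j expR (2 * beta * z j).
transitivity (beta * (\sum_i z i ^+ 2) - ln Z * (\sum_i p i)).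
  by rewrite softmax_sum// mulr1.
rewrite /total_ent !mulr_sumr -sumrB -big_split /=; apply: eq_bigr => i _.
by rewrite /ent ln_softmax -/Z -/p; ring.
Qed.

(* [free_en z] is the minimum over [p] of [beta |z - p|^2 + total_ent p],
   attained at [softmax z]: so minimising [free_en] forces [x = softmax x], with
   no differentiation, and trades [free_en] for the separable [total_ent]. *)
Lemma free_en_min beta x : (0 < q)%N -> 0 < beta ->
  (forall y, free_en beta x <= free_en beta y) ->
  (forall i, x i = softmax beta x i) /\
  (forall y, (forall i, 0 < y i) -> \sum_i y i = 1 ->
     total_ent beta x <= total_ent beta y).
Proof.
move=> q0 beta0 xmin; set p := softmax beta x.
have Gp : free_en beta p <= total_ent beta p.
  by apply: free_en_le_ent => //; [exact: softmax_gt0 | exact: softmax_sum].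
have xp i : x i = p i.
  have : beta * (\sum_i (x i - p i) ^+ 2) <= 0.
    by have := le_trans (xmin p) Gp; rewrite free_en_softmax// gerDr.
  rewrite pmulr_rle0// => s0.
  have s_ge0 : forall j, true -> 0 <= (x j - p j) ^+ 2 by move=> j _; exact: sqr_ge0.
  have : \sum_i (x i - p i) ^+ 2 == 0 by rewrite eq_le s0 sumr_ge0.
  by rewrite psumr_eq0// => /allP/(_ i (mem_index_enum _))/=; rewrite sqrf_eq0 subr_eq0 => /eqP.
split=> // y y0 y1.
have -> : total_ent beta x = free_en beta x.
  rewrite free_en_softmax// -/p big1 ?mulr0 ?add0r.
    by apply: eq_bigr => i _; rewrite xp.
  by move=> i _; rewrite xp subrr expr0n.
by apply: le_trans (xmin y) _; apply: free_en_le_ent.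
Qed.

Lemma total_ent_line beta (i0 : 'I_q) (t : R) : (1 < q)%N ->
  total_ent beta (fun k => if k == i0 then t else (1 - t) / (q%:R - 1)) =
  line_ent beta (q%:R - 1) t.
Proof.
move=> q1; rewrite /total_ent (bigD1 i0)//= eqxx /line_ent; congr (_ + _).
rewrite (eq_bigr (fun=> ent beta ((1 - t) / (q%:R - 1)))); last first.
  by move=> i /negbTE ->.
rewrite sumr_const cardC1 card_ord -[LHS]mulr_natl; congr (_ * _).
by rewrite -subn1 natrB// ltnW.
Qed.

(** The function [ln t - 2 beta t] increases up to [1 / (2 beta)] and decreases afterwards, so two
    points at the same level straddle the maximum. Applying [ln t < t - 1] to [v / u] and [u / v]
    gives this directly. *)
Lemma ln_slope_gap beta (u v : R) : 0 < u < v ->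
  ln u - 2 * beta * u = ln v - 2 * beta * v -> u < (2 * beta)^-1 < v.
Proof.
move=> /andP[u0 uv] e; have v0 : 0 < v by lra.
have vu : 0 < v - u by lra.
have h1 : ln v - ln u < v / u - 1.
  rewrite -ln_div ?posrE//; apply: ln_lt_subr1; first by rewrite divr_gt0.
  by rewrite -(mulfV (lt0r_neq0 u0)) (inj_eq (mulIf (invr_neq0 (lt0r_neq0 u0)))) gt_eqF.
have h2 : ln u - ln v < u / v - 1.
  rewrite -ln_div ?posrE//; apply: ln_lt_subr1; first by rewrite divr_gt0.
  by rewrite -(mulfV (lt0r_neq0 v0)) (inj_eq (mulIf (invr_neq0 (lt0r_neq0 v0)))) lt_eqF.
have k1 : (v - u) * (2 * beta) < (v - u) * u^-1.
  have -> : (v - u) * u^-1 = v / u - 1 by field; rewrite gt_eqF.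
  by apply: le_lt_trans h1; lra.
have k2 : (v - u) * v^-1 < (v - u) * (2 * beta).
  have -> : (v - u) * v^-1 = 1 - u / v by field; rewrite gt_eqF.
  by lra.
move: k1 k2; rewrite !ltr_pM2l// => k1 k2.
have b0 : 0 < 2 * beta by apply: lt_trans k2; rewrite invr_gt0.
by rewrite -[u]invrK -[v]invrK !ltf_pV2 ?posrE ?invr_gt0// k1 k2.
Qed.

(** Above [1 / (2 beta)] the function [ent] is strictly concave, so pushing two equal coordinates
    apart lowers the total and keeps the sum. The step [d] is half the gap, which leaves [a - d]
    above the threshold. *)
Lemma total_ent_pair beta (a : R) x i j : 0 < beta -> i != j ->
  x i = a -> x j = a -> (forall k, 0 < x k) -> \sum_k x k = 1 ->
  (2 * beta)^-1 < a ->
  exists y, [/\ forall k, 0 < y k, \sum_k y k = 1 &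
    total_ent beta y < total_ent beta x].
Proof.
move=> beta0 ij xi xj x0 x1 ha.
have b0 : 0 < (2 * beta)^-1 by rewrite invr_gt0 mulr_gt0.
pose d := (a - (2 * beta)^-1) / 2.
have d0 : 0 < d by rewrite divr_gt0 ?subr_gt0.
have da : d < a - (2 * beta)^-1 by rewrite /d; lra.
pose y k := if k == i then a + d else if k == j then a - d else x k.
have split_sum (f : 'I_q -> R) :
    \sum_k f k = f i + (f j + \sum_(k | (k != i) && (k != j)) f k).
  by rewrite (bigD1 i)//= (bigD1 j) 1?eq_sym.
have yk k : (k != i) && (k != j) -> y k = x k.
  by move=> /andP[/negbTE ki /negbTE kj]; rewrite /y ki kj.
have yi : y i = a + d by rewrite /y eqxx.
have yj : y j = a - d by rewrite /y eq_sym (negbTE ij) eqxx.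
exists y; split.
- move=> k; rewrite /y; case: ifP => _; first by lra.
  by case: ifP => _ //; lra.
- rewrite -x1 !split_sum yi yj xi xj (eq_bigr _ yk); ring.
rewrite /total_ent !split_sum yi yj xi xj.
rewrite (eq_bigr (fun k => ent beta (x k))); last by move=> k /yk ->.
rewrite [X in X < _]addrA [X in _ < X]addrA ltrD2r.
pose f s := ent beta (a + s) + ent beta (a - s).
suff : f d < f 0 by rewrite /f addr0 subr0.
pose df s := (ln (a + s) + 1 - 2 * beta * (a + s))
  - (ln (a - s) + 1 - 2 * beta * (a - s)).
apply: (@derive_lt0_lt _ f df) => //.
- move=> s /andP[s0 sd].
  have p1 : 0 < a + s by lra.
  have p2 : 0 < a - s by lra.
  have D1 := is_derive_ent beta p1.
  have D2 := is_derive_ent beta p2.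
  have D3 : is_derive s (1 : R) (fun s : R => a + s) 1.
    by apply: is_derive_eq; rewrite /=; ring.
  have D4 : is_derive s (1 : R) (fun s : R => a - s) (- 1).
    by apply: is_derive_eq; rewrite /=; ring.
  have D5 := @is_derive1_comp R (ent beta) (fun s : R => a + s) s _ _ D1 D3.
  have D6 := @is_derive1_comp R (ent beta) (fun s : R => a - s) s _ _ D2 D4.
  by rewrite /f; apply: is_derive_eq; rewrite /df; ring.
- move=> s /andP[s0 sd]; rewrite /df ltNge; apply/negP => h.
  have p1 : 0 < a + s by lra.
  have p2 : 0 < a - s by lra.
  have := @ln_le_subr1 R ((a + s) / (a - s)) (divr_gt0 p1 p2).
  rewrite ln_div ?posrE//.
  have -> : (a + s) / (a - s) - 1 = 2 * s * (a - s)^-1 by field; rewrite gt_eqF.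
  have : 2 * s * (a - s)^-1 < 2 * s * (2 * beta).
    rewrite ltr_pM2l; last lra.
    by rewrite -[2 * beta]invrK ltf_pV2 ?posrE//; lra.
  by lra.
Qed.

End Macrostates.

(** * Shape and nondegeneracy of the macrostates *)

Section MacrostateStructure.
Context {R : realType} (q : nat) (hq : (2 < q)%N).
Implicit Types (x y : 'I_q -> R) (beta a b t : R).

Local Notation m := (q%:R - 1 : R).

Lemma m_gt1 : 1 < m.
Proof. by rewrite ltrBrDr -[1 + 1]/(2%:R) ltr_nat. Qed.

(** The case [a = b] is the uniform vector, so ordered and disordered macrostates are treated
    together. *)
Definition two_valued x (i0 : 'I_q) a b :=
  [/\ forall k, x k = if k == i0 then a else b, 0 < b <= a & a + m * b = 1].

Lemma sum_two_valued (i0 : 'I_q) a b :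
  \sum_k (if k == i0 then a else b) = a + m * b.
Proof.
rewrite (bigD1 i0)//= eqxx; congr (_ + _).
rewrite (eq_bigr (fun=> b)); last by move=> i /negbTE ->.
rewrite sumr_const cardC1 card_ord -[LHS]mulr_natl; congr (_ * _).
by rewrite -subn1 natrB// (ltn_trans _ hq).
Qed.

(** All coordinates have the same [ln t - 2 beta t], so distinct ones straddle [1 / (2 beta)]. By
    [total_ent_pair] at most one exceeds this threshold, and the others coincide. With
    [b = (1 - a) / m], the number [2 beta q a b] is the quantity that [line_ent_not_min] compares
    with 1. *)
Lemma ent_min_two_valued beta x : 0 < beta ->
  (forall i, x i = softmax beta x i) ->
  (forall y, (forall i, 0 < y i) -> \sum_i y i = 1 ->
     total_ent beta x <= total_ent beta y) ->
  exists i0 a b, [/\ two_valued x i0 a b, line_slope beta m a = 0 &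
    2 * beta * (q%:R * (a * b)) < 1].
Proof.
move=> beta0 xE xmin.
have q0 : (0 < q)%N by apply: ltn_trans hq.
have q1 : (1 < q)%N by apply: ltn_trans hq.
have x0 k : 0 < x k by rewrite xE softmax_gt0.
have x1 : \sum_k x k = 1.
  by rewrite (eq_bigr (softmax beta x))// softmax_sum.
have slope k l : ln (x k) - 2 * beta * x k = ln (x l) - 2 * beta * x l.
  by rewrite (xE k) (xE l) !ln_softmax -!xE; ring.
have [i0 imax] : exists i0, forall j, x j <= x i0.
  exists [arg max_(i > Ordinal q0) x i]%O.
  by case: arg_maxP => // i _ h j; apply: h.
pose c := (2 * beta)^-1.
have xc j : j != i0 -> x j <= c.
  move=> ji; rewrite leNgt; apply/negP => cj.
  have := imax j; rewrite le_eqVlt => /orP[/eqP e|lt].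
    have [y [y0 y1 lty]] := total_ent_pair beta0 ji erefl (esym e) x0 x1 cj.
    by have := xmin y y0 y1; rewrite leNgt lty.
  have xx : 0 < x j < x i0 by rewrite x0 lt.
  by have /andP[h _] := ln_slope_gap xx (slope _ _); rewrite ltNge (ltW cj) in h.
have xconst j k : j != i0 -> k != i0 -> x j = x k.
  wlog jk : j k / x j < x k.
    move=> H ji ki; have [lt|lt|//] := ltgtP (x j) (x k); first exact: H.
    by apply/esym; apply: H.
  move=> ji ki; have xx : 0 < x j < x k by rewrite x0 jk.
  have /andP[_ h] := ln_slope_gap xx (slope _ _).
  by have := xc k ki; rewrite leNgt h.
have [j ji] : exists j, j != i0.
  exists (if i0 == Ordinal q0 then Ordinal q1 else Ordinal q0).
  by case: ifP => [/eqP -> //|/negbT]; rewrite eq_sym.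
pose a := x i0; pose b := x j.
have xab k : x k = if k == i0 then a else b.
  by case: eqP => [->//|/eqP ki]; apply: xconst.
have ab1 : a + m * b = 1.
  by rewrite -(sum_two_valued i0) -[RHS]x1; apply: eq_bigr => k _; rewrite xab.
have m0 : 0 < m by apply: lt_trans m_gt1.
have bE : (1 - a) / m = b.
  have -> : 1 - a = m * b by lra.
  by field; rewrite gt_eqF.
have a0 : 0 < a by exact: x0.
have b0 : 0 < b by exact: x0.
have mb : 0 < m * b by rewrite mulr_gt0.
have a1 : a < 1 by lra.
exists i0, a, b; split.
- by split=> //; apply/andP; split=> //; apply: imax.
- by rewrite /line_slope bE; have := slope i0 j; rewrite -/a -/b => h; lra.
rewrite ltNge; apply/negP => h.
have [|||t /andP[t0 t1]] := @line_ent_not_min R beta m a m_gt1 _ _ _.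
- by rewrite a0 a1.
- by rewrite /line_slope bE; have := slope i0 j; rewrite -/a -/b => e; lra.
- apply: (le_trans h); rewrite le_eqVlt; apply/orP; left; apply/eqP.
  by rewrite -bE; field; rewrite gt_eqF.
apply/negP; rewrite -leNgt.
rewrite -!(total_ent_line beta i0)//.
have -> : (fun k => if k == i0 then a else (1 - a) / m) = x.
  by apply/funext => k; rewrite bE -xab.
apply: xmin => [k|].
  by case: ifP => // _; rewrite divr_gt0// subr_gt0.
by rewrite sum_two_valued; field; rewrite gt_eqF.
Qed.

(** Where [t (1 - t) < a' (1 - a')] the slope increases strictly. If [a' <= 1/2] this covers the
    interval from [1/q], itself a root, to [a'], a contradiction; if [a' > 1/2] it covers everything
    beyond [a'], so no larger root exists. Used in both directions, it makes the non-uniform value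
    [a] unique. *)
Lemma slope_root_le beta a a' : 0 < beta ->
  line_slope beta m a = 0 -> line_slope beta m a' = 0 ->
  a < 1 -> q%:R^-1 < a' ->
  2 * beta * ((m + 1) / m) * (a' * (1 - a')) < 1 ->
  a <= a'.
Proof.
move=> beta0 La La' a1 qa' Ka'; rewrite leNgt; apply/negP => aa'.
have m0 : 0 < m by apply: lt_trans m_gt1.
set K := 2 * beta * _ in Ka'.
have K0 : 0 < K by rewrite mulr_gt0 ?divr_gt0 ?mulr_gt0//; lra.
have q0 : 0 < q%:R^-1 :> R by rewrite invr_gt0; lra.
have incr (u v : R) : 0 < u -> u < v -> v < 1 ->
    (forall t : R, u < t < v -> 0 < (a' - t) * (1 - a' - t)) ->
    line_slope beta m u < line_slope beta m v.
  move=> u0 uv v1 H.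
  apply: (@derive_gt0_lt R _ (fun t => (t * (1 - t))^-1 - K)) => //.
    by move=> t /andP[ut tv]; apply: is_derive_line_slope => //; lra.
  move=> t /andP[ut tv]; rewrite subr_gt0.
  have t0 : 0 < t * (1 - t) by rewrite mulr_gt0; lra.
  rewrite -div1r ltr_pdivlMr//; apply: lt_trans Ka'.
  rewrite ltr_pM2l// -subr_gt0.
  have -> : a' * (1 - a') - t * (1 - t) = (a' - t) * (1 - a' - t) by ring.
  by apply: H; rewrite ut tv.
have [h|h] := leP a' (1 / 2).
  have : line_slope beta m q%:R^-1 < line_slope beta m a'.
    apply: incr => //; first lra.
    by move=> t /andP[qt ta]; rewrite mulr_gt0//; lra.
  rewrite La'.
  suff -> : line_slope beta m q%:R^-1 = 0 by rewrite ltxx.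
  have e : (1 - q%:R^-1) / m = q%:R^-1 :> R.
    by field; rewrite !gt_eqF//; lra.
  by rewrite /line_slope e !subrr mulr0 subr0.
have : line_slope beta m a' < line_slope beta m a.
  apply: incr => //; first lra.
  by move=> t /andP[qt ta]; rewrite nmulr_rgt0//; lra.
by rewrite La La' ltxx.
Qed.

(** Only two values of [a] can occur, [1/q] and the unique root satisfying [P], so a maximum of
    finitely many rates is a common bound. *)
Lemma macrostates_uniform beta : 0 < beta ->
  exists2 kappa : R, 0 < kappa < 1 &
  forall x : 'rV[R]_q, macrostates beta x ->
    (forall i, x 0 i = softmax beta (x 0) i) /\
    exists i0 a b, two_valued (x 0) i0 a b /\
      2 * beta * (q%:R * (a * b)) <= kappa.
Proof.
move=> beta0.
have q0 : (0 < q)%N by apply: ltn_trans hq.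
have m0 : 0 < m by apply: lt_trans m_gt1.
pose v (a : R) := 2 * beta * ((m + 1) / m) * (a * (1 - a)).
pose P a := q%:R^-1 < a < 1 /\ line_slope beta m a = 0 /\ v a < 1.
have struct (x : 'rV[R]_q) : macrostates beta x ->
    (forall i, x 0 i = softmax beta (x 0) i) /\
    exists i0 a b, [/\ two_valued (x 0) i0 a b,
      2 * beta * (q%:R * (a * b)) = v a, v a < 1 & a = q%:R^-1 \/ P a].
  move=> xmin.
  have xmin' y : free_en beta (x 0) <= free_en beta y.
    have := xmin (\row_k y k); rewrite !free_energyE.
    by have -> : (\row_k y k) 0 = y by apply/funext => k; rewrite mxE.
  have [xE xent] := free_en_min q0 beta0 xmin'.
  split=> //.
  have [i0 [a [b [tv La Ka]]]] := ent_min_two_valued beta0 xE xent.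
  have [_ /andP[b0 ba] ab1] := tv.
  have bE : b = (1 - a) / m.
    have -> : 1 - a = m * b by lra.
    by field; rewrite gt_eqF.
  have vE : 2 * beta * (q%:R * (a * b)) = v a.
    by rewrite bE /v; field; rewrite gt_eqF.
  rewrite vE in Ka.
  exists i0, a, b; split=> //.
  have mb : 0 < m * b by rewrite mulr_gt0.
  have qR0 : 0 < q%:R :> R by rewrite ltr0n.
  have qa : q%:R^-1 <= a.
    rewrite -div1r ler_pdivrMr//.
    have : m * b <= m * a by rewrite ler_pM2l.
    by lra.
  have [->|ne] := eqVneq a q%:R^-1; [by left | right].
  by split; [rewrite lt_neqAle eq_sym ne qa; lra | split].
(* The default 0 is for the case in which the uniform vector is not a macrostate: [struct] gives
   [v a < 1] at every macrostate. The [1/2] in the maxima below ensures [0 < kappa]. *)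
pose vq := if v q%:R^-1 < 1 then v q%:R^-1 else 0.
have vq1 : vq < 1 by rewrite /vq; case: ifP.
have [[a1 Pa1]|noP] := pselect (exists a, P a).
- exists (Num.max (1 / 2) (Num.max vq (v a1))).
    by have [_ [_ h]] := Pa1; rewrite !gt_max !lt_max vq1 h /=; apply/andP; split; lra.
  move=> x /struct[xE [i0 [a [b [tv vE va]]]]] Pa; split=> //.
  exists i0, a, b; split=> //; rewrite vE !le_max.
  case: Pa => [aq|Pa]; first by rewrite /vq -aq va lexx !orbT.
  have -> : a = a1.
    have [/andP[ga ga'] [La Ka]] := Pa; have [/andP[ga1 ga1'] [La1 Ka1]] := Pa1.
    by apply/eqP; rewrite eq_le !(@slope_root_le beta).
  by rewrite lexx !orbT.
- exists (Num.max (1 / 2) vq).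
    by rewrite gt_max lt_max vq1 /=; apply/andP; split; lra.
  move=> x /struct[xE [i0 [a [b [tv vE va]]]]] Pa; split=> //.
  exists i0, a, b; split=> //; rewrite vE !le_max.
  case: Pa => [aq|Pa]; first by rewrite /vq -aq va lexx !orbT.
  by case: noP; exists a.
Qed.

(** Provides [0 < beta] in the theorem. Membership of [1/4] does not suffice: [sup] dominates the
    elements of a set only when the set is bounded above. For [beta > m^2] the defining function
    changes sign between [2/q] and 1, so the intermediate value theorem excludes such [beta]. *)
Lemma spinodal_gt0 : 0 < spinodal q :> R.
Proof.
have m1 := m_gt1; have m0 : 0 < m by lra.
have q0 : 0 < q%:R :> R by rewrite ltr0n (ltn_trans _ hq).
have q3 : 3 <= q%:R :> R by rewrite ler_nat.
rewrite /spinodal; set A := (X in sup X).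
have A4 : A (1 / 4).
  split=> // x /andP[qx x1].
  rewrite subr_eq0 lt_eqF//.
  pose y := x - q%:R^-1.
  have y0 : 0 < y by rewrite subr_gt0.
  have xE : x = y + q%:R^-1 by rewrite /y; lra.
  have qi : 0 < q%:R^-1 :> R by rewrite invr_gt0.
  have y1 : y < 1 by rewrite /y; lra.
  set u := 2 * _ * _.
  have uE : m * u = - (q%:R * y / 2).
    by rewrite /u xE; field; rewrite !gt_eqF.
  have hu : q%:R - q%:R * y / 2 <= 1 + m * expR u.
    have := @expR_ge1Dx R u; rewrite -(ler_pM2l m0) mulrDr mulr1 uE; lra.
  have d0 : 0 < q%:R - q%:R * y / 2.
    have : q%:R * y < q%:R * 1 by rewrite ltr_pM2l.
    by lra.
  have x0 : 0 < x by lra.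
  rewrite -[ltRHS]invrK ltf_pV2 ?posrE ?invr_gt0//; last exact: lt_le_trans hu.
  apply: lt_le_trans hu; rewrite -div1r ltr_pdivrMr// xE.
  have e : (q%:R - q%:R * y / 2) * (y + q%:R^-1) =
      1 + (y * ((q%:R - q%:R * y) / 2) + (q%:R / 2 - 1 / 2) * y).
    by field; rewrite gt_eqF.
  rewrite e ltrDl addr_gt0// mulr_gt0//; last lra.
  rewrite divr_gt0// subr_gt0 -[ltRHS]mulr1 ltr_pM2l//.
apply: (@lt_le_trans _ _ (1 / 4)); first lra.
apply: ub_le_sup => //.
exists (m * m) => beta [beta0 H]; rewrite leNgt; apply/negP => betaB.
pose lin : R -> R := fun x : R => 2 * beta * ((1 - q%:R * x) / m).
pose den : R -> R := fun x : R => 1 + m * expR (lin x).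
pose F : R -> R := fun x : R => (den x)^-1 - x.
(* At [2/q] the exponent is [- 2 beta / m], below [- 2 m]; this forces [den x0 <= 3/2], which is at
   most [q/2 = 1 / x0]. *)
pose x0 : R := 2 / q%:R.
have den_gt1 s : 1 < den s by rewrite ltrDl mulr_gt0// expR_gt0.
have x01 : x0 < 1 by rewrite /x0 ltr_pdivrMr//; lra.
have cF : {within `[x0, 1], continuous F}%classic.
  apply: derivable_within_continuous => s _.
  have D1 : is_derive s (1 : R) lin (2 * beta * (- q%:R / m)).
    by apply: is_derive_eq; rewrite /= /GRing.scale /=; ring.
  have D2 := @is_derive1_comp R (@expR R) lin s _ _ (is_derive_expR _) D1.
  have den0 : den s != 0 by rewrite gt_eqF// (lt_trans _ (den_gt1 s)).
  have D3 : is_derive s (1 : R) den (m * (expR (lin s) * (2 * beta * (- q%:R / m)))).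
    by apply: is_derive_eq; rewrite /= /GRing.scale /=; ring.
  have D4 := is_deriveV den0 D3.
  by apply: derivableB; [have [] := D4 | exact: derivable_id].
have F1 : F 1 < 0.
  by rewrite subr_lt0 invf_lt1// (lt_trans _ (den_gt1 _)).
have F0 : 0 <= F x0.
  have den0 : 0 < den x0 by rewrite (lt_trans _ (den_gt1 _)).
  rewrite subr_ge0 -[leLHS]invrK lef_pV2 ?posrE ?invr_gt0 ?divr_gt0//.
  have -> : x0^-1 = q%:R / 2 by rewrite invf_div.
  rewrite /den.
  have -> : lin x0 = - (2 * beta / m).
    by rewrite /lin /x0; field; rewrite !gt_eqF.
  set w := 2 * beta / m.
  have hw : 2 * m < w by rewrite ltr_pdivlMr//; lra.
  have hN : expR (- w) <= (1 + w)^-1.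
    by rewrite expRN lef_pV2 ?posrE ?expR_gt0 ?expR_ge1Dx//; lra.
  have : m * expR (- w) <= 1 / 2.
    apply: (@le_trans _ _ (m * (1 + w)^-1)); first by rewrite ler_pM2l.
    by rewrite ler_pdivrMr; lra.
  by lra.
have [|c] := @IVT R F x0 1 0 (ltW x01) cF.
  by rewrite ge_min le_max F0 (ltW F1) orbT.
rewrite in_itv /= => /andP[c0 c1] Fc.
have c1' : c < 1.
  by rewrite lt_neqAle c1 andbT; apply/eqP => e; move: F1; rewrite -e Fc ltxx.
have : q%:R^-1 < c < 1.
  rewrite c1' andbT; apply: lt_le_trans c0.
  by rewrite /x0 ltr_pMl ?invr_gt0 ?ltr1n.
by move/H; rewrite -/(lin c) -/(den c) -/(F c) Fc eqxx.
Qed.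

End MacrostateStructure.

(** * Softmax near a macrostate *)

Section SoftmaxTilt.
Context {R : realType} (q : nat) (q0 : (0 < q)%N).
Implicit Types (p h u z c : 'I_q -> R) (beta eta : R).

Lemma expR_approx (u : R) : `|u| <= 1 / 2 -> `|expR u - 1 - u| <= 2 * u ^+ 2.
Proof.
rewrite ler_norml => /andP[u1 u2].
have h1 := expR_ge1Dx u.
have h2 : expR u <= (1 - u)^-1.
  have h := expR_ge1Dx (- u); rewrite expRN in h.
  by rewrite -[expR u]invrK lef_pV2 ?posrE ?invr_gt0 ?expR_gt0//; lra.
rewrite ger0_norm; last lra.
apply: (@le_trans _ _ (u ^+ 2 / (1 - u))).
  have -> : u ^+ 2 / (1 - u) = (1 - u)^-1 - 1 - u by field; rewrite gt_eqF//; lra.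
  by lra.
rewrite ler_pdivrMr; last lra.
have : 0 <= u ^+ 2 * (1 - 2 * u) by rewrite mulr_ge0 ?sqr_ge0//; lra.
by lra.
Qed.

Lemma expR_sub1_le (u eta : R) : `|u| <= eta -> eta <= 1 / 2 ->
  `|expR u - 1| <= 2 * eta.
Proof.
move=> ue e2; have h := expR_approx (le_trans ue e2).
have -> : expR u - 1 = (expR u - 1 - u) + u by ring.
apply: le_trans (ler_normD _ _) _.
have : u ^+ 2 <= eta * (1 / 2).
  by rewrite -real_normK ?num_real// expr2 ler_pM// (le_trans ue).
by move: h ue; set X := `|_ - _ - _|; lra.
Qed.

(** Exponential tilting: a displacement of the argument becomes a reweighting of the law
    [softmax beta z], so differences of softmax reduce to covariances under that law. *)
Lemma softmax_tilt beta z h k :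
  softmax beta (fun i => z i + h i) k =
  softmax beta z k * expR (2 * beta * h k) /
    \sum_j softmax beta z j * expR (2 * beta * h j).
Proof.
have Z0 := sum_expR_gt0 beta z k.
have -> : \sum_j softmax beta z j * expR (2 * beta * h j) =
    (\sum_j expR (2 * beta * (z j + h j))) / \sum_j expR (2 * beta * z j).
  rewrite mulr_suml; apply: eq_bigr => j _.
  by rewrite mulrDr expRD /softmax mulrAC.
rewrite /softmax mulrDr expRD.
have Z1 := sum_expR_gt0 beta (fun i => z i + h i) k.
by field; rewrite !gt_eqF.
Qed.

Section Tilt.
Variables (p u : 'I_q -> R) (eta : R).
Hypotheses (p0 : forall k, 0 <= p k) (p1 : \sum_k p k = 1).
Hypotheses (ueta : forall k, `|u k| <= eta) (eta4 : eta <= 1 / 4).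

Let E := \sum_k p k * expR (u k).

Lemma tilt_mass : `|E - 1| <= 2 * eta.
Proof.
have e4 := eta4.
have -> : E - 1 = \sum_k p k * (expR (u k) - 1).
  under eq_bigr do rewrite mulrBr mulr1.
  by rewrite sumrB p1.
apply: le_trans (ler_norm_sum _ _ _) _.
apply: (@le_trans _ _ (\sum_k p k * (2 * eta))); last by rewrite -mulr_suml p1 mul1r.
apply: ler_sum => k _; rewrite normrM (ger0_norm (p0 k)) ler_wpM2l//.
by apply: (expR_sub1_le (ueta k)); lra.
Qed.

Let E_ge : 1 - 2 * eta <= E.
Proof. by have e4 := eta4; have := tilt_mass; rewrite ler_norml => /andP[h _]; lra. Qed.

Lemma tilt_dist k : `|p k * expR (u k) / E - p k| <= 8 * eta.
Proof.
have e4 := eta4; have Eg := E_ge.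
have e0 : 0 <= eta by apply: le_trans (ueta k).
have E0 : 0 < E by apply: lt_le_trans E_ge; lra.
have pk1 : p k <= 1 by rewrite -p1 (bigD1 k)//= lerDl sumr_ge0.
have -> : p k * expR (u k) / E - p k = p k * (((expR (u k) - 1) - (E - 1)) / E).
  by field; rewrite gt_eqF.
rewrite normrM (ger0_norm (p0 k)).
apply: (@le_trans _ _ (1 * (8 * eta))); last by rewrite mul1r.
apply: ler_pM => //; rewrite normrM normfV (gtr0_norm E0) ler_pdivrMr//.
apply: le_trans (ler_normB _ _) _.
have h1 : `|expR (u k) - 1| <= 2 * eta by apply: (expR_sub1_le (ueta k)); lra.
have h2 := tilt_mass.
have h3 : eta * (1 / 2) <= eta * E by rewrite ler_wpM2l//; lra.
by lra.
Qed.

(* Both local estimates are instances of this: [c] is the indicator of a set for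
   the total variation bound, and [c] is the displacement for the drift bound. *)
Lemma tilt_cov c (cbar M S D : R) : cbar = \sum_k p k * c k ->
  (forall k, `|c k - cbar| <= M) -> 0 <= S ->
  \sum_k u k ^+ 2 <= D ->
  \sum_k p k * (c k - cbar) * u k <= S ->
  \sum_k c k * (p k * expR (u k) / E - p k) <= (S + 2 * M * D) / (1 - 2 * eta).
Proof.
have e4 := eta4; have Eg := E_ge.
move=> cE cM S0 uD cov.
have E0 : 0 < E by apply: lt_le_trans E_ge; lra.
have M0 : 0 <= M by apply: le_trans (cM (Ordinal q0)).
have D0 : 0 <= D by apply: le_trans uD; apply: sumr_ge0 => k _; apply: sqr_ge0.
have pk1 k : p k <= 1 by rewrite -p1 (bigD1 k)//= lerDl sumr_ge0.
have c0 : \sum_k p k * (c k - cbar) = 0.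
  under eq_bigr do rewrite mulrBr.
  by rewrite sumrB -mulr_suml p1 mul1r cE subrr.
have -> : \sum_k c k * (p k * expR (u k) / E - p k) =
    (\sum_k p k * (c k - cbar) * (expR (u k) - 1)) / E.
  have -> : \sum_k p k * (c k - cbar) * (expR (u k) - 1) =
      \sum_k c k * (p k * expR (u k)) - cbar * E.
    transitivity (\sum_k (p k * (c k - cbar) * expR (u k) - p k * (c k - cbar))).
      by apply: eq_bigr => k _; ring.
    rewrite sumrB c0 subr0 /E mulr_sumr -sumrB.
    by apply: eq_bigr => k _; ring.
  rewrite mulrBl mulfK ?gt_eqF// cE mulr_suml -sumrB.
  by apply: eq_bigr => k _; ring.
have num : \sum_k p k * (c k - cbar) * (expR (u k) - 1) <= S + 2 * M * D.
  have -> : \sum_k p k * (c k - cbar) * (expR (u k) - 1) =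
      \sum_k p k * (c k - cbar) * u k +
      \sum_k p k * (c k - cbar) * (expR (u k) - 1 - u k).
    by rewrite -big_split; apply: eq_bigr => k _ /=; ring.
  apply: lerD => //.
  apply: (@le_trans _ _ (\sum_k 2 * M * u k ^+ 2)); last first.
    by rewrite -mulr_sumr ler_wpM2l// mulr_ge0.
  apply: ler_sum => k _; apply: le_trans (ler_norm _) _.
  rewrite !normrM (ger0_norm (p0 k)).
  have h : `|expR (u k) - 1 - u k| <= 2 * u k ^+ 2.
    by apply: expR_approx; apply: le_trans (ueta k) _; lra.
  have hM : p k * `|c k - cbar| <= 1 * M by rewrite ler_pM.
  have -> : 2 * M * u k ^+ 2 = 1 * M * (2 * u k ^+ 2) by ring.
  by rewrite ler_pM// mulr_ge0.
apply: le_trans (_ : (S + 2 * M * D) / E <= _).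
  by rewrite ler_pM2r ?invr_gt0.
rewrite ler_wpM2l ?addr_ge0 ?mulr_ge0//.
by rewrite lef_pV2 ?posrE//; lra.
Qed.

End Tilt.

(** Because [h] sums to 0, a constant may be subtracted from [d]; the midpoint of its range leaves
    values of size at most [K / 2]. *)
Lemma zero_sum_pairing (d h : 'I_q -> R) (K : R) : \sum_k h k = 0 ->
  (forall i j, d i - d j <= K) ->
  \sum_k d k * h k <= K * (1 / 2 * \sum_k `|h k|).
Proof.
move=> h0 dK.
have [i imax] : exists i, forall j, d j <= d i.
  exists [arg max_(i > Ordinal q0) d i]%O.
  by case: arg_maxP => // i _ h' j; apply: h'.
have [j jmin] : exists i, forall j, d i <= d j.
  exists [arg min_(i < Ordinal q0) d i]%O.
  by case: arg_minP => // k _ h' l; apply: h'.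
pose mid := (d i + d j) / 2.
have -> : \sum_k d k * h k = \sum_k (d k - mid) * h k.
  rewrite [RHS](eq_bigr (fun k => d k * h k - mid * h k)); last first.
    by move=> k _; rewrite mulrBl.
  by rewrite sumrB -mulr_sumr h0 mulr0 subr0.
rewrite mulrA mulr_sumr; apply: ler_sum => k _.
apply: le_trans (ler_norm _) _; rewrite normrM ler_wpM2r//.
have := imax k; have := jmin k; have := dK i j.
by rewrite ler_norml /mid => *; apply/andP; split; lra.
Qed.

End SoftmaxTilt.

(** * Contraction of softmax in total variation and in Euclidean norm *)

Section LocalContraction.
Context {R : realType} (q : nat) (hq : (2 < q)%N).
Implicit Types (x p h z : 'I_q -> R) (a b beta : R).

Local Notation m := (q%:R - 1 : R).

(** The worst pair has [i = i0], where the left side is [a (1 - a + b) = q a b] because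
    [1 - a = m b]. *)
Lemma two_valued_rate x i0 a b i j : two_valued x i0 a b -> i != j ->
  x i * (1 - x i + x j) <= q%:R * (a * b).
Proof.
move=> [xE /andP[b0 ba] ab1] ij.
have m1 := @m_gt1 R q hq.
have qab : q%:R * (a * b) = a * (1 - a + b).
  have -> : 1 - a = m * b by lra.
  by ring.
have d0 : 0 <= (a - b) * ((m - 1) * b) by rewrite !mulr_ge0//; lra.
have -> : q%:R * (a * b) = Num.max (a * (1 - a + b)) (b * (1 - b + a)).
  rewrite qab; apply/esym/max_idPl; rewrite -subr_ge0.
  have -> : a * (1 - a + b) - b * (1 - b + a) = (a - b) * (1 - a - b) by ring.
  by have -> : 1 - a - b = (m - 1) * b by lra.
rewrite !xE; case: eqP => [ii|_]; case: eqP => [jj|_].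
- by move: ij; rewrite ii jj eqxx.
- by rewrite le_max lexx.
- by rewrite le_max lexx orbT.
- by rewrite le_max; apply/orP; right; rewrite ler_wpM2l//; lra.
Qed.

(** On zero-sum vectors [q a b] is the largest eigenvalue of the covariance matrix of [x], reached
    in the direction of the corner [i0]. *)
Lemma two_valued_var x i0 a b h : two_valued x i0 a b -> \sum_k h k = 0 ->
  \sum_k x k * (h k - \sum_l x l * h l) * h k <=
  q%:R * (a * b) * \sum_k h k ^+ 2.
Proof.
move=> [xE /andP[b0 ba] ab1] h0.
have m1 := @m_gt1 R q hq; have m0 : 0 < m by lra.
set H := \sum_k h k ^+ 2.
have weighted (f : 'I_q -> R) : \sum_k x k * f k = (a - b) * f i0 + b * \sum_k f k.
  rewrite (bigD1 i0)//= [X in b * X](bigD1 i0)//= xE eqxx mulrDr addrA; congr (_ + _).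
    by ring.
  by rewrite mulr_sumr; apply: eq_bigr => k /negbTE ki; rewrite xE ki.
have hbar : \sum_l x l * h l = (a - b) * h i0 by rewrite weighted h0 mulr0 addr0.
rewrite hbar.
have -> : \sum_k x k * (h k - (a - b) * h i0) * h k =
    \sum_k x k * h k ^+ 2 - (a - b) * h i0 * \sum_k x k * h k.
  by rewrite mulr_sumr -sumrB; apply: eq_bigr => k _; ring.
rewrite hbar weighted -/H.
(* Cauchy-Schwarz for the other [m] coordinates, whose sum is [- h i0], written as nonnegativity of
   their variance. *)
have cs : h i0 ^+ 2 * q%:R <= m * H.
  have : 0 <= \sum_(k | k != i0) (h k + h i0 / m) ^+ 2.
    by apply: sumr_ge0 => k _; apply: sqr_ge0.
  have -> : \sum_(k | k != i0) (h k + h i0 / m) ^+ 2 =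
      \sum_(k | k != i0) h k ^+ 2 + 2 * (h i0 / m) * \sum_(k | k != i0) h k
      + \sum_(k < q | k != i0) (h i0 / m) ^+ 2.
    rewrite mulr_sumr -!big_split /=; apply: eq_bigr => k _; ring.
  have -> : \sum_(k | k != i0) h k = - h i0.
    by have := h0; rewrite (bigD1 i0)//= => e; lra.
  have -> : \sum_(k | k != i0) h k ^+ 2 = H - h i0 ^+ 2.
    by rewrite /H [X in _ = X - _](bigD1 i0)//=; ring.
  rewrite sumr_const cardC1 card_ord -[X in _ + X]mulr_natl.
  have -> : q.-1%:R = m by rewrite -subn1 natrB// (ltn_trans _ hq).
  have -> : H - h i0 ^+ 2 + 2 * (h i0 / m) * - h i0 + m * (h i0 / m) ^+ 2 =
      (m * H - h i0 ^+ 2 * q%:R) / m by field; rewrite gt_eqF.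
  by rewrite pmulr_lge0 ?invr_gt0// subr_ge0.
have am : 1 - a = m * b by lra.
have w0 : 0 <= (a - b) * b by rewrite mulr_ge0//; lra.
have -> : (a - b) * h i0 ^+ 2 + b * H - (a - b) * h i0 * ((a - b) * h i0) =
    b * H + (a - b) * b * (h i0 ^+ 2 * q%:R).
  have e : 1 - a + b = q%:R * b by rewrite am; ring.
  have -> : (a - b) * b * (h i0 ^+ 2 * q%:R) = (a - b) * (1 - a + b) * h i0 ^+ 2.
    by rewrite e; ring.
  by ring.
apply: le_trans (_ : b * H + (a - b) * b * (m * H) <= _).
  by rewrite lerD2l ler_wpM2l.
rewrite le_eqVlt; apply/orP; left; apply/eqP.
have -> : b * H + (a - b) * b * (m * H) = b * H * (1 + a * m - m * b) by ring.
by rewrite -am; ring.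
Qed.

(** Up to [2 beta], [p i * (c i - s)] is the derivative of the softmax mass of [A] in direction [i].
    For [i] in [A] and [j] outside, the difference is [p i (1 - s) + p j s], affine in [s], which
    lies between [p i] and [1 - p j]. The endpoints give the rates of [(i, j)] and [(j, i)], so a
    bound over all sets reduces to pairs. *)
Lemma indicator_cov_le p (A : pred 'I_q) (K : R) : 0 <= K ->
  (forall k, 0 <= p k) -> \sum_k p k = 1 ->
  (forall i j, i != j -> p i * (1 - p i + p j) <= K) ->
  let c k : R := (A k)%:R in let s := \sum_k p k * c k in
  forall i j, p i * (c i - s) - p j * (c j - s) <= K.
Proof.
move=> K0 p0 p1 pK c s i j.
have [->|ij] := eqVneq i j; first by rewrite subrr.
have s_ge k : A k -> p k <= s.
  move=> Ak; rewrite /s (bigD1 k)//= /c Ak mulr1 lerDl.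
  by apply: sumr_ge0 => l _; rewrite mulr_ge0.
have s_le k : ~~ A k -> s <= 1 - p k.
  move=> Ak; rewrite /s (bigD1 k)//= /c (negbTE Ak) mulr0 add0r.
  rewrite -[X in _ <= X - _]p1 [X in _ <= X - _](bigD1 k)//= addrAC subrr add0r.
  by apply: ler_sum => l _; case: (A l); rewrite ?mulr1 ?mulr0.
have s0 : 0 <= s by apply: sumr_ge0 => l _; rewrite mulr_ge0.
have s1 : s <= 1.
  by rewrite -p1; apply: ler_sum => l _; rewrite /c; case: (A l); rewrite ?mulr1 ?mulr0.
have kij := pK i j ij; have kji := pK j i.
rewrite eq_sym in kji; move/(_ ij) in kji.
have pi0 := p0 i; have pj0 := p0 j.
have pij : 0 <= p i * p j by rewrite mulr_ge0.
have pp (u v : R) : 0 <= u -> 0 <= v -> 0 <= u * v by apply: mulr_ge0.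
have [Ai|Ai] := boolP (A i); have [Aj|Aj] := boolP (A j);
  rewrite /c ?Ai ?Aj ?(negbTE Ai) ?(negbTE Aj) /=.
- have si := s_ge _ Ai; have sj := s_ge _ Aj.
  have [h|h] := leP (p j) (p i).
    have : 0 <= p j * (1 - s) by apply: pp => //; lra.
    have : 0 <= p i * (s - p i) by apply: pp => //; lra.
    by lra.
  have : 0 <= (p j - p i) * (1 - s) by apply: pp; lra.
  by lra.
- have si := s_ge _ Ai; have sj := s_le _ Aj.
  have [h|h] := leP (p j) (p i).
    have : 0 <= (p i - p j) * (s - p i) by apply: pp; lra.
    by lra.
  have : 0 <= (p j - p i) * (1 - p j - s) by apply: pp; lra.
  by lra.
- have : 0 <= p i * s by apply: pp.
  have : 0 <= p j * (1 - s) by apply: pp; lra.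
  by lra.
- have si := s_le _ Ai; have sj := s_le _ Aj.
  have [h|h] := leP (p j) (p i).
    have : 0 <= (p i - p j) * s by apply: pp; lra.
    by lra.
  have : 0 <= p j * (1 - p j - s) by apply: pp; lra.
  have : 0 <= p i * s by apply: pp.
  by lra.
Qed.

Lemma rate_perturb (pi pj xi xj e : R) : 0 <= pi <= 1 -> 0 <= pj <= 1 ->
  0 <= xi <= 1 -> `|pi - xi| <= e -> `|pj - xj| <= e ->
  pi * (1 - pi + pj) <= xi * (1 - xi + xj) + 4 * e.
Proof.
move=> /andP[pi0 pi1] /andP[pj0 pj1] /andP[xi0 xi1].
rewrite !ler_norml => /andP[i1 i2] /andP[j1 j2].
have pp (u v : R) : 0 <= u -> 0 <= v -> 0 <= u * v by apply: mulr_ge0.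
have h1 : 0 <= (e - (pi - xi)) * (1 - pi + pj) by apply: pp; lra.
have e0 : 0 <= e by lra.
have h2 : 0 <= xi * (2 * e - ((xi - pi) + (pj - xj))) by apply: pp; lra.
have h3 : 0 <= e * (1 - (pj - pi)) by apply: pp; lra.
have h4 : 0 <= e * (1 - xi) by apply: pp; lra.
have -> : pi * (1 - pi + pj) =
  xi * (1 - xi + xj) + (pi - xi) * (1 - pi + pj) + xi * ((xi - pi) + (pj - xj)) by ring.
by lra.
Qed.

(** The total variation estimate asks for equal sums rather than sums 1, because it will be applied
    to proportions with one vertex left out. *)
Lemma local_contraction beta : 0 < beta ->
  exists kappa r1 : R, [/\ 0 < kappa < 1, 0 < r1 &
  forall x : 'rV[R]_q, macrostates beta x ->
  [/\ forall i, x 0 i = softmax beta (x 0) i,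
    forall z z' : 'I_q -> R, (forall k, `|z k - x 0 k| <= r1) ->
      (forall k, `|z' k - x 0 k| <= r1) -> \sum_k z k = \sum_k z' k ->
      forall A : pred 'I_q,
      \sum_k (A k)%:R * (softmax beta z k - softmax beta z' k) <=
      kappa * (1 / 2 * \sum_k `|z k - z' k|)
   & forall z : 'I_q -> R, (forall k, `|z k - x 0 k| <= r1) -> \sum_k z k = 1 ->
      \sum_k (z k - x 0 k) * (softmax beta z k - x 0 k) <=
      kappa * \sum_k (z k - x 0 k) ^+ 2]].
Proof.
move=> beta0.
have [kappa /andP[k0 k1] Hk] := macrostates_uniform hq beta0.
have q0 : (0 < q)%N by apply: ltn_trans hq.
(* The final rate is [kappa + 2 g = 1 - g]. One [g] pays for replacing [x] by a nearby softmax in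
   the rate, at cost [2 beta * 4 * (8 eta) = 64 beta eta]; the other pays for the quadratic error
   [8 beta eta] and the denominator [1 - 2 eta]. *)
pose g := (1 - kappa) / 3.
have g0 : 0 < g by rewrite /g; lra.
pose eta := g / (64 * beta + 8).
have den0 : 0 < 64 * beta + 8 by lra.
have eta0 : 0 < eta by rewrite divr_gt0.
have etaE : eta * (64 * beta + 8) = g by rewrite /eta mulfVK ?gt_eqF.
have be0 : 0 < beta * eta by rewrite mulr_gt0.
have g3 : g < 1 / 3 by rewrite /g; lra.
have eta8 : eta <= 1 / 8 by lra.
have e4 : eta <= 1 / 4 by lra.
have d0 : 0 < 1 - 2 * eta by lra.
have kappaE : kappa = 1 - 3 * g by rewrite /g; lra.
have final : (kappa + g) + 8 * (beta * eta) <= (kappa + 2 * g) * (1 - 2 * eta).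
  have : eta * (kappa + 2 * g) <= eta * 1 by rewrite ler_wpM2l//; lra.
  by lra.
exists (kappa + 2 * g), (eta / (4 * beta)); split; first by apply/andP; split; lra.
  by rewrite divr_gt0// mulr_gt0.
move=> x xmin; have [xE [i0 [a [b [tv Kab]]]]] := Hk x xmin.
have small (z y : 'I_q -> R) k (n : R) : `|z k - y k| <= n * (eta / (4 * beta)) ->
    `|2 * beta * (z k - y k)| <= n * eta / 2.
  rewrite normrM gtr0_norm ?mulr_gt0// => h.
  apply: (@le_trans _ _ (2 * beta * (n * (eta / (4 * beta))))).
    by rewrite ler_pM2l ?mulr_gt0.
  by rewrite le_eqVlt; apply/orP; left; apply/eqP; field; rewrite gt_eqF.
have x0 k : 0 <= x 0 k by rewrite xE ltW ?softmax_gt0.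
have x1 : \sum_k x 0 k = 1.
  by rewrite (eq_bigr (softmax beta (x 0)))// softmax_sum.
have le1 (p : 'I_q -> R) k : (forall l, 0 <= p l) -> \sum_l p l = 1 -> p k <= 1.
  by move=> p0 <-; rewrite (bigD1 k)//= lerDl sumr_ge0.
split=> //.
- move=> z z' zx z'x zz' A.
  pose h k := z k - z' k.
  pose p := softmax beta z'.
  pose u k := 2 * beta * h k.
  have p0 k : 0 <= p k by rewrite ltW ?softmax_gt0.
  have p1 : \sum_k p k = 1 by rewrite softmax_sum.
  have ueta k : `|u k| <= eta.
    have -> : eta = 2 * eta / 2 by lra.
    apply: small.
    have -> : z k - z' k = (z k - x 0 k) - (z' k - x 0 k) by ring.
    by apply: le_trans (ler_normB _ _) _; have := zx k; have := z'x k; lra.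
  have px k : `|p k - x 0 k| <= 8 * eta.
    pose w k := 2 * beta * (z' k - x 0 k).
    have weta l : `|w l| <= eta.
      apply: (@le_trans _ _ (1 * eta / 2)); first by apply: small; rewrite mul1r.
      by lra.
    have := tilt_dist x0 x1 weta e4 k.
    rewrite {1 3}xE -/w.
    have -> : softmax beta (x 0) k * expR (w k) / (\sum_j x 0 j * expR (w j)) = p k.
      rewrite /p; have -> : z' = (fun i => x 0 i + (z' i - x 0 i)).
        by apply/funext => i; ring.
      rewrite softmax_tilt /w; congr (_ / _).
      by apply: eq_bigr => j _; rewrite -xE.
    by rewrite -xE.
  pose K := (kappa + g) / (2 * beta).
  have b2 : 0 < 2 * beta by rewrite mulr_gt0.
  have K0 : 0 <= K by rewrite divr_ge0//; lra.
  have pK i j : i != j -> p i * (1 - p i + p j) <= K.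
    move=> ij.
    have px1 k : 0 <= p k <= 1 by rewrite p0 le1.
    have xx1 k : 0 <= x 0 k <= 1 by rewrite x0 le1.
    apply: le_trans (rate_perturb (px1 i) (px1 j) (xx1 i) (px i) (px j)) _.
    rewrite /K ler_pdivlMr//.
    have := two_valued_rate tv ij; rewrite -(ler_pM2l b2) => h1.
    by lra.
  have cov := indicator_cov_le A K0 p0 p1 pK.
  pose c k : R := (A k)%:R; pose s := \sum_k p k * c k.
  have h0 : \sum_k h k = 0 by rewrite sumrB zz' subrr.
  pose N1 := 1 / 2 * \sum_k `|h k|.
  have N10 : 0 <= N1 by rewrite mulr_ge0// sumr_ge0.
  have s01 : 0 <= s <= 1.
    rewrite sumr_ge0/=; last by move=> k _; rewrite mulr_ge0.
    by rewrite -p1; apply: ler_sum => l _; rewrite /c; case: (A l); rewrite ?mulr1 ?mulr0.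
  have := @tilt_cov R q q0 p u eta p0 p1 ueta e4 c s 1 ((kappa + g) * N1)
    (4 * (beta * eta) * N1) erefl.
  have -> : \sum_k c k * (p k * expR (u k) / (\sum_k p k * expR (u k)) - p k) =
     \sum_k (A k)%:R * (softmax beta z k - softmax beta z' k).
    apply: eq_bigr => k _; rewrite -/p /c; congr (_ * (_ - _)).
    rewrite -softmax_tilt; congr (softmax _ _ _).
    by apply/funext => i; rewrite /h; ring.
  move=> H; apply: le_trans (H _ _ _ _) _.
  - move=> k; rewrite /c ler_norml; move: s01 => /andP[]; case: (A k) => /=; lra.
  - by rewrite mulr_ge0//; lra.
  (* One factor [|u k|] is bounded by [eta], so the second-order error stays linear in [N1]. *)
  - have -> : 4 * (beta * eta) * N1 = \sum_k eta * (2 * beta * `|h k|).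
      by rewrite -mulr_sumr -mulr_sumr /N1; field.
    apply: ler_sum => k _; rewrite -real_normK ?num_real// expr2.
    have -> : 2 * beta * `|h k| = `|u k| by rewrite normrM gtr0_norm.
    by rewrite ler_wpM2r.
  - have := zero_sum_pairing q0 h0 cov; rewrite -/N1 -(ler_pM2l b2).
    have -> : 2 * beta * (K * N1) = (kappa + g) * N1.
      by rewrite /K; field; rewrite gt_eqF.
    apply: le_trans; rewrite mulr_sumr le_eqVlt; apply/orP; left; apply/eqP.
    by apply: eq_bigr => k _; rewrite /u -/s -/(c k); ring.
  rewrite ler_pdivrMr//.
  have -> : (kappa + g) * N1 + 2 * 1 * (4 * (beta * eta) * N1) =
     (kappa + g + 8 * (beta * eta)) * N1 by ring.
  by rewrite -/N1 -[_ * N1 * _]mulrAC ler_wpM2r.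
- move=> z zx z1.
  pose h k := z k - x 0 k.
  pose u k := 2 * beta * h k.
  have h0 : \sum_k h k = 0 by rewrite sumrB z1 x1 subrr.
  have ueta k : `|u k| <= eta.
    apply: (@le_trans _ _ (1 * eta / 2)); first by apply: small; rewrite mul1r.
    by lra.
  pose s := \sum_k x 0 k * h k.
  pose H2 := \sum_k h k ^+ 2.
  have H20 : 0 <= H2 by apply: sumr_ge0 => k _; apply: sqr_ge0.
  have b2 : 0 < 2 * beta by rewrite mulr_gt0.
  have he k : `|h k| <= eta / (2 * beta).
    by rewrite ler_pdivlMr// mulrC; have := ueta k; rewrite normrM gtr0_norm.
  have sh : `|s| <= eta / (2 * beta).
    set e2 := eta / _ in he *.
    apply: le_trans (ler_norm_sum _ _ _) _.
    rewrite -[leRHS]mul1r -x1 mulr_suml; apply: ler_sum => k _.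
    by rewrite normrM (ger0_norm (x0 k)); apply: ler_wpM2l; [exact: x0|exact: he].
  (* Here the test vector is the displacement itself, so the small factor comes from
     [M = eta / beta], and the error is again [8 beta eta]. *)
  have := @tilt_cov R q q0 (x 0) u eta x0 x1 ueta e4 h s (eta / beta) (kappa * H2)
    (4 * beta ^+ 2 * H2) erefl.
  have -> : \sum_k h k * (x 0 k * expR (u k) / (\sum_k x 0 k * expR (u k)) - x 0 k) =
     \sum_k (z k - x 0 k) * (softmax beta z k - x 0 k).
    apply: eq_bigr => k _; congr (_ * (_ - _)).
    have -> : z = (fun i => x 0 i + h i) by apply/funext => i; rewrite /h; ring.
    by rewrite softmax_tilt -xE; congr (_ / _); apply: eq_bigr => j _; rewrite -xE.
  move=> H; apply: le_trans (H _ _ _ _) _.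
  - move=> k; apply: le_trans (ler_normB _ _) _.
    have -> : eta / beta = eta / (2 * beta) + eta / (2 * beta) by field; rewrite gt_eqF.
    exact: lerD.
  - by rewrite mulr_ge0//; lra.
  - rewrite mulr_sumr; apply: ler_sum => k _.
    by rewrite /u le_eqVlt; apply/orP; left; apply/eqP; ring.
  - have := two_valued_var tv h0; rewrite -(ler_pM2l b2) => h1.
    have h2 : 2 * beta * (q%:R * (a * b) * H2) <= kappa * H2.
      by rewrite mulrA ler_wpM2r.
    apply: le_trans h2; apply: le_trans h1.
    rewrite mulr_sumr le_eqVlt; apply/orP; left; apply/eqP.
    by apply: eq_bigr => k _; rewrite /u -/s; ring.
  rewrite ler_pdivrMr//.
  have -> : kappa * H2 + 2 * (eta / beta) * (4 * beta ^+ 2 * H2) =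
     (kappa + 8 * (beta * eta)) * H2 by field; rewrite gt_eqF.
  by rewrite -/H2 -[_ * H2 * _]mulrAC ler_wpM2r//; lra.
Qed.

End LocalContraction.

(** * Couplings and mixing *)

Section Coupling.
Context {R : realType} {T : finType}.
Implicit Types (p : T -> R) (P : T -> T -> R).

(* The off-diagonal part is the product of the two excesses over the minimum; when
   they vanish the division by [d = 0] gives the expected [0]. *)
Lemma maximal_coupling p p' : (forall k, 0 <= p k) -> (forall k, 0 <= p' k) ->
  \sum_k p k = 1 -> \sum_k p' k = 1 ->
  exists w : T -> T -> R, [/\ forall k l, 0 <= w k l,
    forall k, \sum_l w k l = p k,
    forall l, \sum_k w k l = p' l &
    \sum_k \sum_l w k l * (k != l)%:R <= \sum_k (p' k < p k)%R%:R * (p k - p' k)].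
Proof.
move=> p0 p0' p1 p1'.
pose m k := Num.min (p k) (p' k).
have m0 k : 0 <= m k by rewrite le_min p0 p0'.
have mp k : 0 <= p k - m k by rewrite subr_ge0 ge_min lexx.
have mp' k : 0 <= p' k - m k by rewrite subr_ge0 ge_min lexx orbT.
pose d := \sum_k (p k - m k).
have dE : d = \sum_k (p' k - m k) by rewrite /d !sumrB p1 p1'.
have d0 : 0 <= d by apply: sumr_ge0.
have cancel_d (f : T -> R) k : (forall k, 0 <= f k) -> \sum_k f k = d -> f k * d / d = f k.
  move=> f0 fd; have [dz|dz] := eqVneq d 0; last by rewrite mulfK.
  move/eqP: fd; rewrite dz psumr_eq0// => /allP/(_ k (mem_index_enum _))/= /eqP ->.
  by rewrite !mul0r.
have diag (k : T) (f : T -> R) : \sum_l (k == l)%:R * f l = f k.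
  rewrite (bigD1 k)//= eqxx mul1r big1 ?addr0// => l lk.
  by rewrite eq_sym (negbTE lk) mul0r.
exists (fun k l => (k == l)%:R * m l + (p k - m k) * (p' l - m l) / d); split.
- by move=> k l; rewrite addr_ge0 ?divr_ge0 ?mulr_ge0.
- move=> k; rewrite big_split /= diag -mulr_suml -mulr_sumr -dE (cancel_d (fun k => p k - m k))//.
  by rewrite addrC subrK.
- move=> l; rewrite big_split /=.
  under eq_bigr do rewrite eq_sym.
  rewrite (eq_bigr (fun k => (l == k)%:R * m k)); last first.
    by move=> k _; case: eqP => [->|_]; rewrite ?mul0r.
  rewrite diag -mulr_suml -mulr_suml [d * _]mulrC (cancel_d (fun k => p' k - m k))//.
  by rewrite addrC subrK.
apply: (@le_trans _ _ d); last first.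
  rewrite /d le_eqVlt; apply/orP; left; apply/eqP; apply: eq_bigr => k _.
  by rewrite /m; case: ltP => h; rewrite ?mul1r ?mul0r// subrr.
apply: (@le_trans _ _ (\sum_k \sum_l (p k - m k) * (p' l - m l) / d)).
  apply: ler_sum => k _; apply: ler_sum => l _.
  case: eqP => [->|_] /=; rewrite ?mulr0 ?mulr1 ?mul0r ?add0r//.
  by rewrite divr_ge0 ?mulr_ge0.
rewrite (eq_bigr (fun k => p k - m k)) // => k _.
by rewrite -mulr_suml -mulr_sumr -dE (cancel_d (fun k => p k - m k)).
Qed.

(* Couplings of [P s] and [P s'] are given by a finite probability space [(I, w)]
   carrying two random states, which spares a formula for the joint kernel. *)
Definition step_coupling P (s s' : T) (rho : T -> T -> R) (bound : R) : Prop :=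
  exists (I : finType) (w : I -> R) (X Y : I -> T),
    [/\ forall i, 0 <= w i,
      \sum_i w i = 1,
      forall f : T -> R, \sum_u P s u * f u = \sum_i w i * f (X i),
      forall f : T -> R, \sum_u P s' u * f u = \sum_i w i * f (Y i) &
      \sum_i w i * rho (X i) (Y i) <= bound].

(** The step bound says that [rho - K] contracts by [theta], which iterates over all pairs of
    starting states. [rho] has only to dominate the discrete metric: it may be positive on the
    diagonal, as [coupled_dist] can be. *)
Lemma kernel_iter_contract P (rho : T -> T -> R) (theta K : R) : 0 <= theta ->
  (forall s s', (s != s')%:R <= rho s s') ->
  (forall s s', step_coupling P s s' rho (theta * rho s s' + (1 - theta) * K)) ->
  forall t (A : {set T}) s s',
  `|pr (kernel_iter P t s) A - pr (kernel_iter P t s') A| <=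
  theta ^+ t * (rho s s' - K) + K.
Proof.
move=> th0 rho_ge coup t A; elim: t => [|t IH] s s'.
  rewrite expr0 mul1r subrK; apply: le_trans (rho_ge s s').
  have E u : pr (kernel_iter P 0 u) A = (u \in A)%:R.
    rewrite /pr big_mkcond (bigD1 u)//= eqxx big1 ?addr0; first by case: (u \in A).
    by move=> v vu; rewrite eq_sym (negbTE vu); case: ifP.
  rewrite !E; have [->|_] := eqVneq s s'; first by rewrite subrr normr0.
  by case: (s \in A); case: (s' \in A); rewrite ?subrr ?subr0 ?sub0r ?normrN ?normr0 ?normr1.
have [I [w [X [Y [w0 w1 fX fY wr]]]]] := coup s s'.
have E u : pr (kernel_iter P t.+1 u) A = \sum_v P u v * pr (kernel_iter P t v) A.
  rewrite /pr /= exchange_big /=; apply: eq_bigr => v _; by rewrite mulr_sumr.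
rewrite !E fX fY -sumrB.
apply: le_trans (ler_norm_sum _ _ _) _.
apply: (@le_trans _ _ (\sum_i w i * (theta ^+ t * (rho (X i) (Y i) - K) + K))).
  by apply: ler_sum => i _; rewrite -mulrBr normrM (ger0_norm (w0 i)) ler_wpM2l.
have -> : \sum_i w i * (theta ^+ t * (rho (X i) (Y i) - K) + K) =
    theta ^+ t * (\sum_i w i * rho (X i) (Y i)) + (K - theta ^+ t * K) * \sum_i w i.
  by rewrite !mulr_sumr -big_split /=; apply: eq_bigr => i _; ring.
rewrite w1 mulr1.
have tt0 : 0 <= theta ^+ t by rewrite exprn_ge0.
apply: (@le_trans _ _ (theta ^+ t * (theta * rho s s' + (1 - theta) * K) + (K - theta ^+ t * K))).
  by rewrite lerD2r ler_wpM2l.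
by rewrite le_eqVlt exprS; apply/orP; left; apply/eqP; ring.
Qed.

Lemma stationary_iter P p t u : (forall v, \sum_s p s * P s v = p v) ->
  \sum_s p s * kernel_iter P t s u = p u.
Proof.
move=> st; elim: t => [|t IH] /=.
  rewrite (bigD1 u)//= eqxx mulr1 big1 ?addr0// => s su.
  by rewrite (negbTE su) mulr0.
under eq_bigr do rewrite mulr_sumr.
rewrite exchange_big /= -[RHS]IH; apply: eq_bigr => v _.
by rewrite -[in RHS](st v) mulr_suml; apply: eq_bigr => s _; rewrite mulrA.
Qed.

(** By stationarity [p] is itself an average of the time-[t] laws, so it suffices to compare pairs
    of starting states. *)
Lemma tv_dist_stationary P p (e : R) t s : 0 <= e ->
  (forall s, 0 <= p s) -> \sum_s p s = 1 ->
  (forall v, \sum_s p s * P s v = p v) ->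
  (forall s' (A : {set T}),
    `|pr (kernel_iter P t s) A - pr (kernel_iter P t s') A| <= e) ->
  tv_dist (kernel_iter P t s) p <= e.
Proof.
move=> e0 p0 p1 st H; apply: bigmax_le => // A _.
have -> : pr p A = \sum_s' p s' * pr (kernel_iter P t s') A.
  rewrite /pr; under [RHS]eq_bigr do rewrite mulr_sumr.
  by rewrite exchange_big /=; apply: eq_bigr => u _; rewrite stationary_iter.
have -> : pr (kernel_iter P t s) A - \sum_s' p s' * pr (kernel_iter P t s') A =
    \sum_s' p s' * (pr (kernel_iter P t s) A - pr (kernel_iter P t s') A).
  under [RHS]eq_bigr do rewrite mulrBr.
  by rewrite sumrB -mulr_suml p1 mul1r.
apply: le_trans (ler_norm_sum _ _ _) _.
rewrite -[e]mul1r -p1 mulr_suml; apply: ler_sum => s' _.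
by rewrite normrM (ger0_norm (p0 s')) ler_wpM2l.
Qed.

Lemma mixing_time_le P p (e : R) t : 0 <= e ->
  (forall s, tv_dist (kernel_iter P t s) p <= e) ->
  (mixing_time P p e <= t%:R%:E)%E.
Proof.
move=> e0 H; apply: ereal_inf_lbound; exists t => //=.
by apply: bigmax_le.
Qed.

End Coupling.

(** * The Glauber kernel *)

Section GlauberKernel.
Context {R : realType} (q N : nat).
Implicit Types (s t : config q N) (v w : 'I_N) (k l : 'I_q) (beta : R).

Lemma recolorE s v k w : recolor s v k w = if w == v then k else s w.
Proof. by rewrite ffunE. Qed.

Lemma recolor_id s v : recolor s v (s v) = s.
Proof. by apply/ffunP => w; rewrite recolorE; case: eqP => [->|]. Qed.

Lemma recolor_recolor s v k l : recolor (recolor s v k) v l = recolor s v l.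
Proof. by apply/ffunP => w; rewrite !recolorE; case: eqP. Qed.

Lemma sum_fibre s v (P : pred (config q N)) (F : config q N -> R) :
  \sum_(t in [set t : config q N | [forall w, (w != v) ==> (t w == s w)]] | P t) F t =
  \sum_(k | P (recolor s v k)) F (recolor s v k).
Proof.
rewrite (reindex_onto (recolor s v) (fun t => t v)) /=.
  apply: eq_bigl => k; rewrite inE recolorE eqxx eqxx andbT.
  suff -> : [forall w, (w != v) ==> (recolor s v k w == s w)] by [].
  by apply/forallP => w; apply/implyP => wv; rewrite recolorE (negbTE wv).
move=> t /andP[]; rewrite inE => /forallP tE _.
apply/ffunP => w; rewrite recolorE; case: eqP => [->//|/eqP wv].
by have /implyP/(_ wv)/eqP -> := tE w.
Qed.

Definition prop_at s k : R := N%:R^-1 * \sum_w (s w == k)%:R.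

Lemma proportionsE s k : proportions s 0 k = prop_at s k.
Proof.
rewrite mxE mulrC /prop_at; congr (_ * _).
by rewrite -sum1_card natr_sum big_mkcond; apply: eq_bigr => w _; rewrite inE; case: ifP.
Qed.

(** Divided by [N], not [N - 1], so that the colour law is exactly the softmax of this vector. *)
Definition prop_off s v k : R := N%:R^-1 * \sum_(w | w != v) (s w == k)%:R.

Lemma prop_offE s v k : prop_off s v k = prop_at s k - (s v == k)%:R / N%:R.
Proof. by rewrite /prop_off /prop_at [in RHS](bigD1 v)//=; ring. Qed.

(** Ordered pairs count each pair containing [v] twice, hence the [2 beta]; the pair [(v, v)] gives
    the 1. Only the last term depends on [k]. *)
Lemma energy_recolor s v k beta :
  - beta * hamiltonian (recolor s v k) =
  (beta * N%:R^-1 * (1 + \sum_(u | u != v) \sum_(w | w != v) (s u == s w)%:R))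
  + 2 * beta * prop_off s v k.
Proof.
rewrite /hamiltonian /prop_off.
have -> : \sum_(u < N) \sum_(w < N) (recolor s v k u == recolor s v k w)%:R =
    1 + \sum_(u | u != v) \sum_(w | w != v) (s u == s w)%:R +
    2 * \sum_(w | w != v) (s w == k)%:R :> R.
  rewrite (bigD1 v)//= (bigD1 v)//= eqxx.
  have -> : \sum_(w | w != v) (recolor s v k v == recolor s v k w)%:R =
      \sum_(w | w != v) (s w == k)%:R :> R.
    by apply: eq_bigr => w wv; rewrite !recolorE eqxx (negbTE wv) eq_sym.
  have -> : \sum_(u | u != v) \sum_(w < N) (recolor s v k u == recolor s v k w)%:R =
      \sum_(w | w != v) (s w == k)%:R +
      \sum_(u | u != v) \sum_(w | w != v) (s u == s w)%:R :> R.
    rewrite -big_split /=; apply: eq_bigr => u uv; rewrite (bigD1 v)//=.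
    rewrite !recolorE eqxx (negbTE uv); congr (_ + _).
    by apply: eq_bigr => w wv; rewrite !recolorE (negbTE wv).
  by rewrite mulr1n; ring.
by ring.
Qed.

Definition weight beta s : R := expR (- beta * hamiltonian s).

Lemma partition_gt0 s beta : 0 < \sum_t weight beta t.
Proof.
rewrite (bigD1 s)//= ltr_pwDl ?expR_gt0//.
by apply: sumr_ge0 => t _; apply: expR_ge0.
Qed.

Lemma colour_law_weight beta s v k :
  colour_law beta s v k = weight beta (recolor s v k) / \sum_l weight beta (recolor s v l).
Proof.
have Z0 := partition_gt0 s beta.
rewrite /colour_law /cond_pr /pr.
have -> : \sum_(t in [set t : config q N | t v == k] :&:
    [set t : config q N | [forall w, (w != v) ==> (t w == s w)]]) gibbs beta t =
    gibbs beta (recolor s v k).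
  rewrite (eq_bigl (fun t => (t \in [set t : config q N |
      [forall w, (w != v) ==> (t w == s w)]]) && (t v == k))); last first.
    by move=> t; rewrite !inE andbC.
  rewrite sum_fibre (eq_bigl (pred1 k)) ?big_pred1_eq// => l.
  by rewrite recolorE eqxx.
have -> : \sum_(t in [set t : config q N | [forall w, (w != v) ==> (t w == s w)]])
    gibbs beta t = (\sum_l weight beta (recolor s v l)) / \sum_t weight beta t.
  rewrite (eq_bigl (fun t => (t \in [set t : config q N |
      [forall w, (w != v) ==> (t w == s w)]]) && true)); last first.
    by move=> t; rewrite andbT.
  by rewrite (sum_fibre s v xpredT) mulr_suml.
rewrite /gibbs -/(weight beta (recolor s v k)) /partition_fun.
have Y0 : 0 < \sum_l weight beta (recolor s v l).
  rewrite (bigD1 k)//= ltr_pwDl ?expR_gt0//.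
  by apply: sumr_ge0 => t _; apply: expR_ge0.
by field; rewrite !gt_eqF.
Qed.

Lemma colour_law_softmax beta s v k :
  colour_law beta s v k = softmax beta (prop_off s v) k.
Proof.
pose c := expR (beta * N%:R^-1 *
  (1 + \sum_(u | u != v) \sum_(w | w != v) (s u == s w)%:R)).
have wE l : weight beta (recolor s v l) = c * expR (2 * beta * prop_off s v l).
  by rewrite /weight energy_recolor expRD.
rewrite colour_law_weight /softmax wE (eq_bigr _ (fun l _ => wE l)) -mulr_sumr.
have Y0 := sum_expR_gt0 beta (prop_off s v) k.
by field; rewrite !gt_eqF// expR_gt0.
Qed.

Section Ball.
Variables (beta r : R) (x : 'rV[R]_q).
Notation state := (ball_state q N x r).
Implicit Types (a b u : state).

Definition move a v k : state := insubd a (recolor (val a) v k).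

Lemma glauber_expect a (f : state -> R) :
  \sum_u glauber beta a u * f u =
  \sum_v N%:R^-1 * \sum_k colour_law beta (val a) v k * f (move a v k).
Proof.
rewrite /glauber.
under eq_bigr do rewrite mulr_suml.
rewrite exchange_big /=; apply: eq_bigr => v _.
under eq_bigr do rewrite -mulrA mulr_suml.
rewrite -mulr_sumr exchange_big /=; congr (_ * _); apply: eq_bigr => k _.
rewrite (bigD1 (move a v k))//= -/(move a v k) eqxx mulr1 big1 ?addr0// => u.
by rewrite -/(move a v k) eq_sym => /negbTE ->; rewrite mulr0 mul0r.
Qed.

(** A rejection keeps the state, so between distinct states only accepted recolourings count. The
    normalising sum depends on the colours off [v] alone and is therefore common to both states. *)
Lemma detailed_balance v a b :
  weight beta (val a) * (\sum_k colour_law beta (val a) v k * (move a v k == b)%:R) =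
  weight beta (val b) * (\sum_k colour_law beta (val b) v k * (move b v k == a)%:R).
Proof.
wlog ab : a b / a != b => [H|].
  by have [->//|ab] := eqVneq a b; apply: H.
have moveE c d k : c != d -> (move c v k == d) = (recolor (val c) v k == val d).
  move=> cd; rewrite /move -val_eqE val_insubd.
  case: ifP => // out; rewrite val_eqE (negbTE cd); apply/esym/negbTE/eqP => e.
  by move: out; rewrite e (valP d).
have sumE c d : c != d ->
    \sum_k colour_law beta (val c) v k * (move c v k == d)%:R =
    (recolor (val c) v (val d v) == val d)%:R *
    (weight beta (val d) / \sum_l weight beta (recolor (val c) v l)).
  move=> cd; rewrite (bigD1 (val d v))//= big1 ?addr0; last first.
    move=> k kd; rewrite moveE//; case: eqP => [e|_]; last by rewrite mulr0.
    by move: kd; rewrite -e recolorE !eqxx.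
  rewrite moveE// colour_law_weight; case: eqP => [->|_]; first by rewrite mulr1 mul1r.
  by rewrite mulr0 mul0r.
have ba : b != a by rewrite eq_sym.
rewrite (sumE _ _ ab) (sumE _ _ ba).
have [e|e] := eqVneq (recolor (val a) v (val b v)) (val b).
  have e' : recolor (val b) v (val a v) = val a.
    by rewrite -e recolor_recolor recolor_id.
  rewrite e' eqxx !mul1r.
  have -> : \sum_l weight beta (recolor (val b) v l) = \sum_l weight beta (recolor (val a) v l).
    by apply: eq_bigr => l _; rewrite -e recolor_recolor.
  by ring.
have [e'|e'] := eqVneq (recolor (val b) v (val a v)) (val a); last by rewrite !mul0r !mulr0.
by move: e; rewrite -e' recolor_recolor recolor_id eqxx.
Qed.

Lemma gibbs_ballE a : gibbs_ball beta a = weight beta (val a) / \sum_(b : state) weight beta (val b).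
Proof.
have Z0 := partition_gt0 (val a) beta.
rewrite /gibbs_ball /cond_pr /pr.
have -> : [set val a] :&: config_ball x r = [set val a].
  by apply/finset.setIidPl; rewrite finset.sub1set (valP a).
rewrite finset.big_set1.
have -> : \sum_(t : config q N | t \in config_ball x r) gibbs beta t =
    (\sum_(b : state) weight beta (val b)) / \sum_t weight beta t.
  transitivity ((\sum_(t : config q N | t \in config_ball x r) weight beta t) / \sum_t weight beta t).
    by rewrite mulr_suml; apply: eq_bigr.
  by congr (_ / _); apply: big_sub.
rewrite /gibbs -/(weight beta (val a)) /partition_fun.
have Y0 : 0 < \sum_(b : state) weight beta (val b).
  rewrite (bigD1 a)//= ltr_pwDl ?expR_gt0//.
  by apply: sumr_ge0 => t _; apply: expR_ge0.
by field; rewrite !gt_eqF.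
Qed.

Lemma gibbs_ball_ge0 a : 0 <= gibbs_ball beta a.
Proof. by rewrite gibbs_ballE divr_ge0 ?expR_ge0 ?sumr_ge0// => b _; apply: expR_ge0. Qed.

Lemma gibbs_ball_sum a : \sum_(b : state) gibbs_ball beta b = 1.
Proof.
under eq_bigr do rewrite gibbs_ballE.
rewrite -mulr_suml mulfV// gt_eqF// (bigD1 a)//= ltr_pwDl ?expR_gt0//.
by apply: sumr_ge0 => t _; apply: expR_ge0.
Qed.

Lemma colour_law_sum s v : (0 < q)%N -> \sum_k colour_law beta s v k = 1.
Proof.
by move=> q0; under eq_bigr do rewrite colour_law_softmax; rewrite softmax_sum.
Qed.

Lemma gibbs_ball_stationary b : (0 < q)%N -> (0 < N)%N ->
  \sum_(a : state) gibbs_ball beta a * glauber beta a b = gibbs_ball beta b.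
Proof.
move=> q0 N0.
have NR : N%:R != 0 :> R by rewrite pnatr_eq0 -lt0n.
have rev a : gibbs_ball beta a * glauber beta a b = gibbs_ball beta b * glauber beta b a.
  rewrite !gibbs_ballE /glauber !mulr_sumr; apply: eq_bigr => v _.
  have := detailed_balance v a b; rewrite /move => e.
  rewrite mulrACA [RHS]mulrACA.
  transitivity (N%:R^-1 / (\sum_(c : state) weight beta (val c)) * (weight beta (val a) *
    (\sum_k colour_law beta (val a) v k * (move a v k == b)%:R))); first by ring.
  by rewrite e; ring.
rewrite (eq_bigr _ (fun a _ => rev a)) -mulr_sumr.
have -> : \sum_(a : state) glauber beta b a = 1; last by rewrite mulr1.
transitivity (\sum_(a : state) glauber beta b a * 1); first by apply: eq_bigr => a _; rewrite mulr1.
rewrite (glauber_expect b (fun=> 1)).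
under eq_bigr do under eq_bigr do rewrite mulr1.
under eq_bigr do rewrite colour_law_sum// mulr1.
by rewrite sumr_const card_ord -[LHS]mulr_natl mulfV.
Qed.

End Ball.

End GlauberKernel.

(** * Coupling the restricted dynamics *)

Section Drift.
Context {R : realType} (q N : nat) (q0 : (0 < q)%N) (N0 : (0 < N)%N).
Variables (beta : R) (x : 'rV[R]_q).
Implicit Types (s t : config q N) (v w : 'I_N) (k l j : 'I_q).

Local Notation n := (N%:R : R).
Local Notation dev s k := (prop_at s k - x 0 k).

Definition sqdist s : R := \sum_k dev s k ^+ 2.

Lemma sqdist_ge0 s : 0 <= sqdist s.
Proof. by apply: sumr_ge0 => k _; apply: sqr_ge0. Qed.

Lemma dev_le_sqdist s k : dev s k ^+ 2 <= sqdist s.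
Proof.
rewrite /sqdist (bigD1 k)//= lerDl; apply: sumr_ge0 => l _; exact: sqr_ge0.
Qed.

Lemma in_config_ball s r : 0 <= r -> (s \in config_ball x r) = (sqdist s <= r ^+ 2).
Proof.
move=> r0; rewrite inE /l2norm.
have -> : \sum_i (proportions s - x) 0 i ^+ 2 = sqdist s.
  by apply: eq_bigr => k _; rewrite !mxE -proportionsE !mxE.
by rewrite -[r in LHS](ger0_norm r0) -sqrtr_sqr ler_sqrt// sqr_ge0.
Qed.

Lemma sum_delta (f : 'I_q -> R) k : \sum_j (k == j)%:R * f j = f k.
Proof.
rewrite (bigD1 k)//= eqxx mul1r big1 ?addr0// => j jk.
by rewrite eq_sym (negbTE jk) mul0r.
Qed.

Lemma prop_at_recolor s v k j :
  prop_at (recolor s v k) j = prop_at s j + ((k == j)%:R - (s v == j)%:R) / n.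
Proof.
have e : prop_off (recolor s v k) v j = prop_off s v j :> R.
  rewrite /prop_off; congr (_ * _); apply: eq_bigr => w wv.
  by rewrite recolorE (negbTE wv).
have := prop_offE (R := R) (recolor s v k) v j; rewrite e prop_offE recolorE eqxx => h.
by rewrite mulrBl; lra.
Qed.

Lemma prop_at_sum s : \sum_k prop_at s k = 1 :> R.
Proof.
rewrite -mulr_sumr exchange_big /=.
under eq_bigr => w _.
  rewrite (eq_bigr (fun k => (s w == k)%:R * 1)); last by move=> k _; rewrite mulr1.
  by rewrite (sum_delta (fun=> 1)); over.
by rewrite sumr_const card_ord mulVf// pnatr_eq0 -lt0n.
Qed.

Lemma sqdist_recolor s v k :
  exists2 Q : R, 0 <= Q <= 2 &
  sqdist (recolor s v k) = sqdist s + 2 / n * (dev s k - dev s (s v)) + Q / n ^+ 2.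
Proof.
have n0 : 0 < n by rewrite ltr0n.
pose D j : R := (k == j)%:R - (s v == j)%:R.
exists (\sum_j D j ^+ 2).
  rewrite sumr_ge0 /=; last by move=> j _; apply: sqr_ge0.
  have -> : \sum_j D j ^+ 2 = D k - D (s v).
    transitivity (\sum_j (k == j)%:R * D j - \sum_j (s v == j)%:R * D j).
      by rewrite -sumrB; apply: eq_bigr => j _; rewrite /D; ring.
    by rewrite !sum_delta.
  by rewrite /D !eqxx; case: (s v == k); case: (k == s v) => /=; lra.
have -> : dev s k - dev s (s v) = \sum_j D j * dev s j.
  transitivity (\sum_j (k == j)%:R * dev s j - \sum_j (s v == j)%:R * dev s j).
    by rewrite !sum_delta.
  by rewrite -sumrB; apply: eq_bigr => j _; rewrite /D; ring.
rewrite /sqdist mulr_sumr mulr_suml -!big_split /=; apply: eq_bigr => j _.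
by rewrite prop_at_recolor -/(D j); field; rewrite gt_eqF.
Qed.

Lemma dev_diff_sqr s k l : (dev s k - dev s l) ^+ 2 <= 4 * sqdist s.
Proof.
have := dev_le_sqdist s k; have := dev_le_sqdist s l.
by have := sqr_ge0 (dev s k + dev s l); rewrite !expr2; lra.
Qed.

(** The [1 / n^2] error keeps a factor [sqdist s], since squared differences of deviations are at
    most [4 * sqdist s]; without that factor the drift error could not be brought down to
    [O(1 / n^3)]. *)
Lemma sqdist_sqr_recolor s v k :
  sqdist (recolor s v k) ^+ 2 <= sqdist s ^+ 2
    + 4 * sqdist s / n * (dev s k - dev s (s v))
    + 36 * sqdist s / n ^+ 2 + 8 / n ^+ 4.
Proof.
have n0 : 0 < n by rewrite ltr0n.
have [Q /andP[Q0 Q2] ->] := sqdist_recolor s v k.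
have V0 := sqdist_ge0 s; have dl := dev_diff_sqr s k (s v).
set V := sqdist s in V0 dl *; set d := dev s k - dev s (s v) in dl *.
set i := n^-1; have i0 : 0 < i by rewrite invr_gt0.
rewrite -[(n ^+ 2)^-1]exprVn -[(n ^+ 4)^-1]exprVn -/i.
have h1 : (2 * i * d + Q * i ^+ 2) ^+ 2 <= 32 * V * i ^+ 2 + 8 * i ^+ 4.
  apply: (@le_trans _ _ (2 * (4 * i ^+ 2 * d ^+ 2) + 2 * (Q ^+ 2 * i ^+ 4))).
    rewrite -subr_ge0.
    have -> : 2 * (4 * i ^+ 2 * d ^+ 2) + 2 * (Q ^+ 2 * i ^+ 4) -
      (2 * i * d + Q * i ^+ 2) ^+ 2 = (2 * i * d - Q * i ^+ 2) ^+ 2 by ring.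
    exact: sqr_ge0.
  have a1 : 4 * i ^+ 2 * d ^+ 2 <= 4 * i ^+ 2 * (4 * V).
    by rewrite ler_wpM2l// mulr_ge0// sqr_ge0.
  have a2 : Q ^+ 2 * i ^+ 4 <= 4 * i ^+ 4.
    rewrite ler_wpM2r// ?exprn_ge0 ?(ltW i0)//.
    have -> : 4 = 2 ^+ 2 :> R by ring.
    by rewrite ler_pXn2r// nnegrE.
  by lra.
have h2 : 2 * V * (Q * i ^+ 2) <= 4 * V * i ^+ 2.
  have : Q * (V * i ^+ 2) <= 2 * (V * i ^+ 2).
    by rewrite ler_wpM2r// mulr_ge0// sqr_ge0.
  by lra.
have -> : (V + 2 * i * d + Q * i ^+ 2) ^+ 2 =
  V ^+ 2 + 2 * V * (2 * i * d) + 2 * V * (Q * i ^+ 2) + (2 * i * d + Q * i ^+ 2) ^+ 2 by ring.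
by lra.
Qed.

Variables (kappa r1 : R).
Hypotheses (beta0 : 0 < beta) (kappa01 : 0 < kappa < 1).
Hypothesis drift : forall z : 'I_q -> R, (forall k, `|z k - x 0 k| <= r1) ->
  \sum_k z k = 1 ->
  \sum_k (z k - x 0 k) * (softmax beta z k - x 0 k) <=
  kappa * \sum_k (z k - x 0 k) ^+ 2.

Lemma colour_law_ge0 s v k : 0 <= colour_law beta s v k.
Proof. by rewrite colour_law_softmax ltW// softmax_gt0. Qed.

Lemma colour_law_near s v k : 8 * beta <= n ->
  `|colour_law beta s v k - softmax beta (prop_at s) k| <= 16 * beta / n.
Proof.
move=> Nb; have b0 := beta0; have n0 : 0 < n by rewrite ltr0n.
pose u j : R := 2 * beta * (- ((s v == j)%:R / n)).
have ueta j : `|u j| <= 2 * beta / n.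
  rewrite /u mulrN normrN ger0_norm; last by rewrite !mulr_ge0 ?invr_ge0 ?(ltW b0).
  rewrite mulrA ler_pM2r ?invr_gt0//; case: (s v == j); rewrite /= ?mulr1//.
  by rewrite mulr0; lra.
have e4 : 2 * beta / n <= 1 / 4 by rewrite ler_pdivrMr//; lra.
have p0 j : 0 <= softmax beta (prop_at s) j by rewrite ltW ?softmax_gt0.
have := tilt_dist p0 (softmax_sum _ _ q0) ueta e4 k.
rewrite /u -softmax_tilt colour_law_softmax.
have -> : (fun i => prop_at s i + - ((s v == i)%:R / n)) = prop_off s v.
  by apply/funext => i; rewrite prop_offE.
by have -> : 8 * (2 * beta / n) = 16 * beta / n by ring.
Qed.

Lemma mean_displacement s : 8 * beta <= n ->
  (forall k, `|dev s k| <= r1) -> (forall k, `|dev s k| <= 1) ->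
  n^-1 * \sum_v \sum_k colour_law beta s v k * (dev s k - dev s (s v)) <=
  - (1 - kappa) * sqdist s + 16 * beta * q%:R / n.
Proof.
move=> Nb near1 near; have b0 := beta0; have n0 : 0 < n by rewrite ltr0n.
have e1 v : \sum_k colour_law beta s v k * (dev s k - dev s (s v)) <=
    \sum_k softmax beta (prop_at s) k * dev s k + 16 * beta * q%:R / n - dev s (s v).
  under eq_bigr do rewrite mulrBr.
  rewrite sumrB -mulr_suml colour_law_sum// mul1r lerD2r.
  have -> : 16 * beta * q%:R / n = \sum_(k < q) 16 * beta / n.
    by rewrite sumr_const card_ord -mulr_natr; ring.
  rewrite -big_split /=; apply: ler_sum => k _; rewrite addrC -lerBlDr -mulrBl.
  apply: le_trans (ler_norm _) _; rewrite normrM -[leRHS]mulr1.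
  by apply: ler_pM => //; apply: colour_law_near.
have e2 : n^-1 * \sum_v dev s (s v) = \sum_k prop_at s k * dev s k.
  rewrite (eq_bigr (fun v => \sum_k (s v == k)%:R * dev s k)); last first.
    by move=> v _; rewrite (sum_delta (fun k => dev s k)).
  rewrite exchange_big mulr_sumr; apply: eq_bigr => k _ /=.
  by rewrite /prop_at -mulr_suml mulrA.
apply: (@le_trans _ _ (n^-1 * \sum_(v < N) (\sum_k softmax beta (prop_at s) k * dev s k
    + 16 * beta * q%:R / n - dev s (s v)))).
  by rewrite ler_pM2l ?invr_gt0//; apply: ler_sum => v _.
rewrite sumrB mulrBr e2 sumr_const card_ord -[X in n^-1 * X]mulr_natl mulKf ?gt_eqF//.
have := drift near1 (prop_at_sum s); rewrite -/(sqdist s) => h.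
(* The two averages combine into the left side of [drift] minus [sqdist s], whence the pull
   [- (1 - kappa)]. *)
have h2 : \sum_k softmax beta (prop_at s) k * dev s k - \sum_k prop_at s k * dev s k =
   \sum_k dev s k * (softmax beta (prop_at s) k - x 0 k) - sqdist s.
  by rewrite /sqdist -!sumrB; apply: eq_bigr => k _; ring.
by lra.
Qed.

(** [64 beta q + 36] is the coefficient of [sqdist / n^2]: four times the self-contribution of the
    vertex, plus the error of [sqdist_sqr_recolor]. *)
Definition drift_const : R := (64 * beta * q%:R + 36) ^+ 2 / (4 * (1 - kappa)) + 8.

Lemma sqdist_sqr_drift s : 8 * beta <= n ->
  (forall k, `|dev s k| <= r1) -> (forall k, `|dev s k| <= 1) ->
  n^-1 * \sum_v \sum_k colour_law beta s v k * sqdist (recolor s v k) ^+ 2 <=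
  (1 - (1 - kappa) / n) * sqdist s ^+ 2 + drift_const / n ^+ 3.
Proof.
move=> Nb near1 near; have b0 := beta0; have n0 : 0 < n by rewrite ltr0n.
have /andP[k0 k1] := kappa01.
have n1 : 1 <= n by rewrite ler1n.
have V0 := sqdist_ge0 s; have md := mean_displacement Nb near1 near.
set V := sqdist s in V0 md *.
set B := n^-1 * _ in md.
apply: (@le_trans _ _ (V ^+ 2 + 4 * V / n * B + 36 * V / n ^+ 2 + 8 / n ^+ 4)).
  pose c := V ^+ 2 + 36 * V / n ^+ 2 + 8 / n ^+ 4.
  apply: (@le_trans _ _ (n^-1 * \sum_v \sum_k (colour_law beta s v k * c +
      4 * V / n * (colour_law beta s v k * (dev s k - dev s (s v)))))).
    rewrite ler_pM2l ?invr_gt0//; apply: ler_sum => v _; apply: ler_sum => k _.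
    apply: le_trans (_ : colour_law beta s v k *
        (c + 4 * V / n * (dev s k - dev s (s v))) <= _); last by rewrite le_eqVlt; apply/orP; left; apply/eqP; ring.
    rewrite ler_wpM2l ?colour_law_ge0//.
    by apply: le_trans (sqdist_sqr_recolor s v k) _; rewrite -/V /c; lra.
  have -> : \sum_v \sum_k (colour_law beta s v k * c +
      4 * V / n * (colour_law beta s v k * (dev s k - dev s (s v)))) =
      n * c + 4 * V / n * \sum_v \sum_k colour_law beta s v k * (dev s k - dev s (s v)).
    under eq_bigr do rewrite big_split /= -mulr_suml colour_law_sum// mul1r -mulr_sumr.
    by rewrite big_split /= -mulr_sumr sumr_const card_ord -[X in X + _]mulr_natl.
  rewrite mulrDr mulKf ?gt_eqF// /B /c le_eqVlt; apply/orP; left; apply/eqP; ring.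
set i := n^-1; have i0 : 0 < i by rewrite invr_gt0.
rewrite -[(n ^+ 2)^-1]exprVn -[(n ^+ 4)^-1]exprVn -[(n ^+ 3)^-1]exprVn -/i in md *.
have i1 : i <= 1 by rewrite invf_le1.
set g := 1 - kappa in md *; have g0 : 0 < g by rewrite subr_gt0.
set C := 64 * beta * q%:R + 36.
have h1 : 4 * V * i * B <= 4 * V * i * (- g * V + 16 * beta * q%:R * i).
  by rewrite ler_wpM2l// !mulr_ge0// ltW.
(* Young's inequality, spending one of the four units [g V^2 / n] of drift; one more remains as the
   claimed contraction. *)
have h2 : C * V * i ^+ 2 <= g * V ^+ 2 * i + C ^+ 2 / (4 * g) * i ^+ 3.
  rewrite -subr_ge0.
  have -> : g * V ^+ 2 * i + C ^+ 2 / (4 * g) * i ^+ 3 - C * V * i ^+ 2 =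
    (g * V - C * i / 2) ^+ 2 * (i / g) by field; rewrite gt_eqF.
  by rewrite mulr_ge0 ?sqr_ge0// divr_ge0// ltW.
have h3 : i ^+ 4 <= i ^+ 3.
  by rewrite exprS ler_piMl// exprn_ge0// ltW.
have h4 : 0 <= g * V ^+ 2 * i by rewrite !mulr_ge0 ?sqr_ge0// ltW.
rewrite /drift_const -/g -/C.
move: h2; rewrite /C; set E := _ / (4 * g) => h2.
by lra.
Qed.

End Drift.

(** * A distance with boundary penalty and its contraction *)

Section RestrictedCoupling.
Context {R : realType} (q N : nat) (q0 : (0 < q)%N) (N0 : (0 < N)%N).
Variables (beta r kappa r1 : R) (x : 'rV[R]_q).
Implicit Types (s t : config q N) (v w : 'I_N) (k l j : 'I_q).

Local Notation n := (N%:R : R).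
Local Notation state := (ball_state q N x r).

Definition hamming s t : R := \sum_w (s w != t w)%:R.

Definition hamming_off v s t : R := \sum_(w | w != v) (s w != t w)%:R.

Lemma hammingE v s t : hamming s t = (s v != t v)%:R + hamming_off v s t.
Proof. by rewrite /hamming (bigD1 v). Qed.

Lemma hamming_ge0 s t : 0 <= hamming s t.
Proof. by apply: sumr_ge0. Qed.

Lemma hamming_off_ge0 v s t : 0 <= hamming_off v s t.
Proof. by apply: sumr_ge0. Qed.

Lemma hamming_le s t : hamming s t <= n.
Proof.
have -> : n = \sum_(w < N) 1 by rewrite sumr_const card_ord.
by apply: ler_sum => w _; case: (s w != t w).
Qed.

Lemma hamming_neq s t : (s != t)%:R <= hamming s t.
Proof.
have [->|st] := eqVneq s t; first exact: hamming_ge0.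
have [w sw] : exists w, s w != t w.
  apply/existsP; rewrite -negb_forall; apply: contra st => /forallP h.
  by apply/eqP/ffunP => w; apply/eqP.
by rewrite (hammingE w) sw lerDl hamming_off_ge0.
Qed.

Lemma hamming_off_recolor v s t k l :
  hamming_off v (recolor s v k) (recolor t v l) = hamming_off v s t.
Proof. by apply: eq_bigr => w wv; rewrite !recolorE (negbTE wv). Qed.

Lemma hamming_recolor v s t k l :
  hamming (recolor s v k) (recolor t v l) = (k != l)%:R + hamming_off v s t.
Proof. by rewrite (hammingE v) hamming_off_recolor !recolorE eqxx. Qed.

Lemma move_recolor (a : state) v k : exists l, val (move a v k) = recolor (val a) v l.
Proof.
rewrite /move val_insubd; case: ifP => _; first by exists k.
by exists (val a v); rewrite recolor_id.
Qed.

Lemma hamming_move (a b : state) v k l :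
  hamming (val (move a v k)) (val (move b v l)) <= hamming (val a) (val b) + 1.
Proof.
have [k' ->] := move_recolor a v k; have [l' ->] := move_recolor b v l.
rewrite hamming_recolor (hammingE v (val a)).
have h : (k' != l')%:R <= 1 :> R by case: (k' != l').
have h' : 0 <= (val a v != val b v)%:R :> R by [].
by lra.
Qed.

Lemma sum_hamming_off s t :
  n^-1 * \sum_v hamming_off v s t = hamming s t - hamming s t / n.
Proof.
have n0 : 0 < n by rewrite ltr0n.
have -> : \sum_v hamming_off v s t = \sum_(v < N) hamming s t - \sum_v (s v != t v)%:R.
  by rewrite -sumrB; apply: eq_bigr => v _; rewrite (hammingE v); ring.
rewrite sumr_const card_ord -[X in X - _]mulr_natl -/(hamming s t).
by field; rewrite gt_eqF.
Qed.

Hypotheses (r_gt0 : 0 < r) (r_le1 : r <= 1) (r_le : r <= r1).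
Hypotheses (beta0 : 0 < beta) (kappa01 : 0 < kappa < 1).
Hypothesis lipschitz : forall z z' : 'I_q -> R,
  (forall k, `|z k - x 0 k| <= r1) -> (forall k, `|z' k - x 0 k| <= r1) ->
  \sum_k z k = \sum_k z' k -> forall A : pred 'I_q,
  \sum_k (A k)%:R * (softmax beta z k - softmax beta z' k) <=
  kappa * (1 / 2 * \sum_k `|z k - z' k|).
Hypothesis drift : forall z : 'I_q -> R, (forall k, `|z k - x 0 k| <= r1) ->
  \sum_k z k = 1 ->
  \sum_k (z k - x 0 k) * (softmax beta z k - x 0 k) <=
  kappa * \sum_k (z k - x 0 k) ^+ 2.
Hypotheses (N_beta : 8 * beta <= n) (N_r : 4 <= n * r).

Lemma dev_le s (e : R) k : 0 <= e -> sqdist x s <= e ^+ 2 ->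
  `|prop_at s k - x 0 k| <= e.
Proof.
move=> e0 h; rewrite -(ler_pXn2r (ltn0Sn 1)) ?nnegrE// real_normK ?num_real//.
exact: le_trans (dev_le_sqdist x s k) h.
Qed.

Lemma sqdist_state (a : state) : sqdist x (val a) <= r ^+ 2.
Proof. by rewrite -in_config_ball ?(valP a)// ltW. Qed.

(* A rejected proposal lies farther from [x] than the current state, so rejection
   can only help the drift. *)
Lemma sqdist_move (a : state) v k :
  sqdist x (val (move a v k)) <= sqdist x (recolor (val a) v k).
Proof.
rewrite /move val_insubd; case: ifP => // /negbT out.
apply: le_trans (sqdist_state a) _.
by move: out; rewrite in_config_ball ?(ltW r_gt0)// -ltNge => /ltW.
Qed.

(** By [1/n <= r/4] the three terms of [sqdist_recolor] are at most [r^2/4], [r^2/2] and [r^2/8],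
    with sum below [r^2]. *)
Lemma move_interior (a : state) v k : sqdist x (val a) <= (r / 2) ^+ 2 ->
  val (move a v k) = recolor (val a) v k.
Proof.
have rp := r_gt0; have r2 : 0 <= r / 2 by lra.
move=> h; rewrite /move val_insubd ifT// in_config_ball; last lra.
have n0 : 0 < n by rewrite ltr0n.
have [Q /andP[Q0 Q2] ->] := sqdist_recolor N0 x (val a) v k.
have d1 := dev_le k r2 h; have d2 := dev_le (val a v) r2 h.
move: d1 d2; rewrite !ler_norml => /andP[a1 a2] /andP[b1 b2].
set i := n^-1; have i0 : 0 < i by rewrite invr_gt0.
have ir : i <= r / 4.
  have := N_r; rewrite -(ler_pM2l i0) mulrA mulVf ?gt_eqF// mul1r.
  by lra.
rewrite -exprVn -/i.
have h1 : i * (prop_at (val a) k - x 0 k - (prop_at (val a) (val a v) - x 0 (val a v)))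
    <= r / 4 * r.
  apply: (@le_trans _ _ (i * r)); first by rewrite ler_pM2l//; lra.
  by rewrite ler_pM2r.
have h2 : Q * i ^+ 2 <= 2 * (r / 4 * (r / 4)).
  by apply: ler_pM => //; rewrite ?sqr_ge0// expr2 ler_pM// ltW.
have h3 : 0 <= r ^+ 2 by exact: sqr_ge0.
have h4 : (r / 2) ^+ 2 = r ^+ 2 / 4 by field.
have h5 : r / 4 * r = r ^+ 2 / 4 by field.
have h6 : r / 4 * (r / 4) = r ^+ 2 / 16 by field.
by rewrite h4 in h; rewrite h5 in h1; rewrite h6 in h2; lra.
Qed.

Lemma prop_off_sum s v : \sum_k prop_off s v k = 1 - n^-1 :> R.
Proof.
under eq_bigr do rewrite prop_offE.
rewrite sumrB (prop_at_sum N0) -mulr_suml.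
rewrite (eq_bigr (fun k => (s v == k)%:R * 1)); last by move=> k _; rewrite mulr1.
by rewrite (sum_delta (fun=> 1)) mul1r.
Qed.

Lemma prop_off_near s v k : sqdist x s <= (r / 2) ^+ 2 ->
  `|prop_off s v k - x 0 k| <= r1.
Proof.
have rp := r_gt0; have r2 : 0 <= r / 2 by lra.
have rr := r_le; have n0 : 0 < n by rewrite ltr0n.
move=> h; rewrite prop_offE.
have -> : prop_at s k - (s v == k)%:R / n - x 0 k =
  (prop_at s k - x 0 k) - (s v == k)%:R / n by ring.
apply: le_trans (ler_normB _ _) _.
have h1 := dev_le k r2 h.
have h2 : `|(s v == k)%:R / n| <= r / 4.
  have nr := N_r.
  have p0 : 0 <= (s v == k)%:R / n by rewrite divr_ge0// ltW.
  rewrite (ger0_norm p0).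
  rewrite ler_pdivrMr//; case: (s v == k) => /=; last by rewrite mulr_ge0//; lra.
  by lra.
by lra.
Qed.

Lemma prop_off_dist s t v :
  1 / 2 * \sum_k `|prop_off s v k - prop_off t v k| <= hamming_off v s t / n.
Proof.
have n0 : 0 < n by rewrite ltr0n.
rewrite ler_pdivlMr//.
apply: (@le_trans _ _ (1 / 2 * \sum_(w | w != v) \sum_k
    `|(s w == k)%:R - (t w == k)%:R|)).
  rewrite -[leLHS]mulrA ler_pM2l; last lra.
  rewrite exchange_big mulr_suml; apply: ler_sum => k _ /=.
  rewrite /prop_off -mulrBr -sumrB normrM gtr0_norm ?invr_gt0// mulrC mulVKf ?gt_eqF//.
  exact: ler_norm_sum.
rewrite /hamming_off mulr_sumr; apply: ler_sum => w _.
have [->|sw] := eqVneq (s w) (t w).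
  by rewrite big1 ?mulr0// => k _; rewrite subrr normr0.
apply: (@le_trans _ _ (1 / 2 * \sum_k ((s w == k)%:R * 1 + (t w == k)%:R * 1))).
  rewrite ler_pM2l; last lra.
  apply: ler_sum => k _; apply: le_trans (ler_normB _ _) _.
  by rewrite !mulr1 !ger0_norm.
by rewrite big_split /= !(sum_delta (fun=> 1)) /=; lra.
Qed.

Definition colour_coupling s t v (W : 'I_q -> 'I_q -> R) :=
  [/\ forall k l, 0 <= W k l,
    forall k, \sum_l W k l = colour_law beta s v k,
    forall l, \sum_k W k l = colour_law beta t v l &
    sqdist x s <= (r / 2) ^+ 2 -> sqdist x t <= (r / 2) ^+ 2 ->
    \sum_k \sum_l W k l * (k != l)%:R <= kappa * (hamming_off v s t / n)].

Lemma colour_coupling_exists s t v : exists W, colour_coupling s t v W.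
Proof.
have [W [W0 Wl Wr Wd]] := @maximal_coupling R 'I_q (colour_law beta s v)
  (colour_law beta t v) (colour_law_ge0 beta s v) (colour_law_ge0 beta t v)
  (colour_law_sum beta s v q0) (colour_law_sum beta t v q0).
exists W; split=> // hs ht; apply: le_trans Wd _.
(* The disagreement probability is bounded by the mass difference on this set, a case of
   [lipschitz]. *)
pose A k := colour_law beta t v k < colour_law beta s v k.
rewrite (eq_bigr (fun k => (A k)%:R *
  (softmax beta (prop_off s v) k - softmax beta (prop_off t v) k))); last first.
  by move=> k _; rewrite -!colour_law_softmax.
have [k0 _] := andP kappa01.
apply: le_trans (lipschitz _ _ _ A) _.
- by move=> k; apply: prop_off_near.
- by move=> k; apply: prop_off_near.
- by rewrite !prop_off_sum.
- by rewrite ler_pM2l// prop_off_dist.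
Qed.

(** Makes [32 / r^4], the boundary cost in [hamming_coupled_step], equal to half the decay
    [(1 - kappa) / n] of a penalty of weight [coupling_weight * n]. *)
Definition coupling_weight : R := 64 / ((1 - kappa) * r ^+ 4).

(* The squares make the additive error of the drift O(1 / N^3), so that the factor
   [n] needed to absorb the boundary states leaves an error O(1 / N^2). *)
Definition coupled_dist (a b : state) : R := hamming (val a) (val b)
  + coupling_weight * n * (sqdist x (val a) ^+ 2 + sqdist x (val b) ^+ 2).

(** The two chains' additive errors, [coupling_weight * n * drift_const / n^3] each, divided by the
    rate [(1 - kappa) / (2 n)]. *)
Definition coupling_floor : R :=
  4 * coupling_weight * drift_const q beta kappa / (1 - kappa) / n.

Lemma coupling_weight_gt0 : 0 < coupling_weight.
Proof.
have [k0 k1] := andP kappa01.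
by rewrite divr_gt0// mulr_gt0 ?subr_gt0// exprn_gt0.
Qed.

Lemma sqdist_sqr_move_drift (a : state) :
  n^-1 * \sum_v \sum_k colour_law beta (val a) v k * sqdist x (val (move a v k)) ^+ 2 <=
  (1 - (1 - kappa) / n) * sqdist x (val a) ^+ 2 + drift_const q beta kappa / n ^+ 3.
Proof.
have n0 : 0 < n by rewrite ltr0n.
have rp := ltW r_gt0.
have near k := dev_le k rp (sqdist_state a).
apply: le_trans (sqdist_sqr_drift q0 N0 beta0 kappa01 drift N_beta _ _).
- rewrite ler_pM2l ?invr_gt0//; apply: ler_sum => v _; apply: ler_sum => k _.
  rewrite ler_wpM2l ?colour_law_ge0//.
  by rewrite ler_pXn2r ?nnegrE ?sqdist_ge0// sqdist_move.
- by move=> k; apply: le_trans (near k) r_le.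
- by move=> k; apply: le_trans (near k) r_le1.
Qed.

(** If a chain is outside the ball of radius [r/2], its [sqdist^2] exceeds [r^4/16], so the penalty
    with coefficient [16 / r^4] is at least 1. It is used twice: for a possible growth by 1, and for
    the claimed decrease, which is at most 1 because [d <= n]. *)
Lemma hamming_coupled_step (a b : state) (W : 'I_N -> 'I_q -> 'I_q -> R) :
  (forall v, colour_coupling (val a) (val b) v (W v)) ->
  n^-1 * \sum_v \sum_k \sum_l W v k l *
    hamming (val (move a v k)) (val (move b v l)) <=
  (1 - (1 - kappa) / n) * hamming (val a) (val b)
  + 32 / r ^+ 4 * (sqdist x (val a) ^+ 2 + sqdist x (val b) ^+ 2).
Proof.
move=> HW; have n0 : 0 < n by rewrite ltr0n.
have [k0 k1] := andP kappa01.
have rp := r_gt0; have r40 : 0 < r ^+ 4 by rewrite exprn_gt0.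
set d := hamming (val a) (val b); have d0 : 0 <= d by exact: hamming_ge0.
have dn : d <= n by exact: hamming_le.
have W1 v : \sum_k \sum_l W v k l = 1.
  have [_ Wl _ _] := HW v; rewrite (eq_bigr _ (fun k _ => Wl k)).
  exact: colour_law_sum.
have [[ha hb]|far] := pselect (sqdist x (val a) <= (r / 2) ^+ 2 /\
                               sqdist x (val b) <= (r / 2) ^+ 2).
  apply: (@le_trans _ _ (n^-1 * \sum_v (hamming_off v (val a) (val b) + kappa * (d / n)))).
    rewrite ler_pM2l ?invr_gt0//; apply: ler_sum => v _.
    have [W0 Wl Wr Wd] := HW v.
    have -> : \sum_k \sum_l W v k l * hamming (val (move a v k)) (val (move b v l)) =
      (\sum_k \sum_l W v k l) * hamming_off v (val a) (val b) +
      \sum_k \sum_l W v k l * (k != l)%:R.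
      rewrite mulr_suml -big_split /=; apply: eq_bigr => k _.
      rewrite mulr_suml -big_split /=; apply: eq_bigr => l _.
      by rewrite !move_interior// hamming_recolor; ring.
    rewrite W1 mul1r lerD2l; apply: le_trans (Wd ha hb) _.
    rewrite ler_pM2l// ler_pM2r ?invr_gt0// /d (hammingE v).
    by rewrite lerDr.
  rewrite big_split /= mulrDr sum_hamming_off sumr_const card_ord.
  rewrite -[X in n^-1 * X]mulr_natl mulKf ?gt_eqF// -/d.
  have : 0 <= 32 / r ^+ 4 * (sqdist x (val a) ^+ 2 + sqdist x (val b) ^+ 2).
    by rewrite mulr_ge0 ?divr_ge0 ?addr_ge0 ?sqr_ge0 ?(ltW r40).
  have -> : (1 - (1 - kappa) / n) * d = d - d / n + kappa * (d / n) by ring.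
  by lra.
apply: (@le_trans _ _ (d + 1)).
  apply: (@le_trans _ _ (n^-1 * \sum_(v < N) (d + 1))); last first.
    by rewrite sumr_const card_ord -[X in n^-1 * X]mulr_natl mulKf// gt_eqF.
  rewrite ler_pM2l ?invr_gt0//; apply: ler_sum => v _.
  have [W0 _ _ _] := HW v.
  have -> : d + 1 = (\sum_k \sum_l W v k l) * (d + 1) by rewrite W1 mul1r.
  rewrite mulr_suml; apply: ler_sum => k _.
  rewrite mulr_suml; apply: ler_sum => l _.
  by rewrite ler_wpM2l// hamming_move.
have far1 : 1 <= 16 / r ^+ 4 * (sqdist x (val a) ^+ 2 + sqdist x (val b) ^+ 2).
  have -> : 16 / r ^+ 4 = ((r / 2) ^+ 4)^-1 by field; rewrite gt_eqF.
  rewrite mulrC ler_pdivlMr ?exprn_gt0 ?divr_gt0// mul1r.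
  have e4 : (r / 2) ^+ 4 = ((r / 2) ^+ 2) ^+ 2 by rewrite -exprM.
  have big (c : state) : (r / 2) ^+ 2 < sqdist x (val c) ->
      (r / 2) ^+ 4 <= sqdist x (val c) ^+ 2.
    by move=> h; rewrite e4 ler_pXn2r ?nnegrE ?sqr_ge0 ?sqdist_ge0// ltW.
  have sa := sqr_ge0 (sqdist x (val a)); have sb := sqr_ge0 (sqdist x (val b)).
  have [ha|/big ha] := leP (sqdist x (val a)) ((r / 2) ^+ 2); last by lra.
  have [hb|/big hb] := leP (sqdist x (val b)) ((r / 2) ^+ 2); last by lra.
  by case: far.
have h : (1 - kappa) / n * d <= 1.
  rewrite mulrAC ler_pdivrMr// mul1r; apply: le_trans dn.
  by rewrite ler_piMl//; lra.
by lra.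
Qed.

(** The sample space records the vertex and both proposed colours. Half of the penalty's decay pays
    for the boundary term in the Hamming distance, hence the halved rate. *)
Lemma glauber_coupling (a b : state) :
  step_coupling (glauber beta (x := x) (r := r)) a b coupled_dist
    ((1 - (1 - kappa) / (2 * n)) * coupled_dist a b +
     (1 - (1 - (1 - kappa) / (2 * n))) * coupling_floor).
Proof.
have n0 : 0 < n by rewrite ltr0n.
have [k0 k1] := andP kappa01.
have [W HW] := choice (colour_coupling_exists (val a) (val b)).
have triple (F : 'I_N -> 'I_q -> 'I_q -> R) :
    \sum_(i : 'I_N * 'I_q * 'I_q) F i.1.1 i.1.2 i.2 = \sum_v \sum_k \sum_l F v k l.
  rewrite (pair_bigA _ (fun v k => \sum_l F v k l)) /=.
  by rewrite (pair_bigA _ (fun p l => F p.1 p.2 l)).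
have left_marginal (f : 'I_N -> 'I_q -> R) :
    \sum_v \sum_k \sum_l n^-1 * W v k l * f v k =
    n^-1 * \sum_v \sum_k colour_law beta (val a) v k * f v k.
  rewrite mulr_sumr; apply: eq_bigr => v _; rewrite mulr_sumr; apply: eq_bigr => k _.
  have [_ <- _ _] := HW v.
  by rewrite -mulr_suml -mulr_sumr mulrA.
have right_marginal (f : 'I_N -> 'I_q -> R) :
    \sum_v \sum_k \sum_l n^-1 * W v k l * f v l =
    n^-1 * \sum_v \sum_k colour_law beta (val b) v k * f v k.
  rewrite mulr_sumr; apply: eq_bigr => v _; rewrite mulr_sumr exchange_big /=.
  apply: eq_bigr => l _; have [_ _ <- _] := HW v.
  by rewrite -mulr_suml -mulr_sumr mulrA.
exists ('I_N * 'I_q * 'I_q)%type, (fun i => n^-1 * W i.1.1 i.1.2 i.2),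
  (fun i => move a i.1.1 i.1.2), (fun i => move b i.1.1 i.2); split.
- by move=> i; have [W0 _ _ _] := HW i.1.1; rewrite mulr_ge0 ?invr_ge0 ?(ltW n0).
- rewrite (triple (fun v k l => n^-1 * W v k l)).
  transitivity (\sum_v \sum_k \sum_l n^-1 * W v k l * 1).
    by do 3![apply: eq_bigr => ? _]; rewrite mulr1.
  rewrite (left_marginal (fun _ _ => 1)).
  under eq_bigr do under eq_bigr do rewrite mulr1.
  under eq_bigr do rewrite colour_law_sum//.
  by rewrite sumr_const card_ord mulVf// gt_eqF.
- move=> f; rewrite (triple (fun v k l => n^-1 * W v k l * f (move a v k))).
  rewrite left_marginal glauber_expect mulr_sumr; exact: eq_bigr.
- move=> f; rewrite (triple (fun v k l => n^-1 * W v k l * f (move b v l))).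
  rewrite (right_marginal (fun v k => f (move b v k))) glauber_expect mulr_sumr.
  exact: eq_bigr.
rewrite (triple (fun v k l => n^-1 * W v k l * coupled_dist (move a v k) (move b v l))).
pose Aw := coupling_weight * n.
have Aw0 : 0 < Aw by rewrite mulr_gt0 ?coupling_weight_gt0.
have -> : \sum_v \sum_k \sum_l n^-1 * W v k l * coupled_dist (move a v k) (move b v l) =
  n^-1 * \sum_v \sum_k \sum_l W v k l *
    hamming (val (move a v k)) (val (move b v l)) +
  Aw * (n^-1 * \sum_v \sum_k colour_law beta (val a) v k * sqdist x (val (move a v k)) ^+ 2) +
  Aw * (n^-1 * \sum_v \sum_k colour_law beta (val b) v k * sqdist x (val (move b v k)) ^+ 2).
  rewrite -(left_marginal (fun v k => sqdist x (val (move a v k)) ^+ 2)).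
  rewrite -(right_marginal (fun v k => sqdist x (val (move b v k)) ^+ 2)).
  rewrite !mulr_sumr -!big_split /=; apply: eq_bigr => v _.
  rewrite !mulr_sumr -!big_split /=; apply: eq_bigr => k _.
  rewrite !mulr_sumr -!big_split /=; apply: eq_bigr => l _.
  by rewrite /coupled_dist -/Aw; ring.
have hH := hamming_coupled_step HW.
have hA := sqdist_sqr_move_drift a; have hB := sqdist_sqr_move_drift b.
rewrite -(ler_pM2l Aw0) in hA; rewrite -(ler_pM2l Aw0) in hB.
apply: le_trans (lerD (lerD hH hA) hB) _.
rewrite /coupled_dist /coupling_floor -/Aw.
set d := hamming _ _; have d0 : 0 <= d by exact: hamming_ge0.
set U := sqdist x (val a) ^+ 2; set U' := sqdist x (val b) ^+ 2.
set D := drift_const q beta kappa.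
have g0 : 0 < 1 - kappa by rewrite subr_gt0.
have e1 : 32 / r ^+ 4 = Aw * ((1 - kappa) / (2 * n)).
  by rewrite /Aw /coupling_weight; field; rewrite !gt_eqF.
have e2 : (1 - (1 - (1 - kappa) / (2 * n))) *
    (4 * coupling_weight * D / (1 - kappa) / n) = 2 * (Aw * (D / n ^+ 3)).
  by rewrite /Aw; field; rewrite !gt_eqF.
rewrite e1 e2.
have e3 : (1 - kappa) / n = 2 * ((1 - kappa) / (2 * n)) by field; rewrite gt_eqF.
rewrite e3; set g := (1 - kappa) / (2 * n).
have gd : 0 <= g * d by rewrite mulr_ge0// divr_ge0 ?mulr_ge0// ltW.
rewrite -subr_ge0.
have -> : (1 - g) * (d + Aw * (U + U')) + 2 * (Aw * (D / n ^+ 3)) -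
  ((1 - 2 * g) * d + Aw * g * (U + U') + Aw * ((1 - 2 * g) * U + D / n ^+ 3) +
   Aw * ((1 - 2 * g) * U' + D / n ^+ 3)) = g * d by ring.
exact: gd.
Qed.

Lemma tv_dist_bound T (a : state) :
  tv_dist (kernel_iter (glauber beta (x := x) (r := r)) T a)
    (gibbs_ball beta (x := x) (r := r)) <=
  (1 - (1 - kappa) / (2 * n)) ^+ T * (n + 2 * coupling_weight * n) + coupling_floor.
Proof.
have n0 : 0 < n by rewrite ltr0n.
have n1 : 1 <= n by rewrite ler1n.
have [k0 k1] := andP kappa01.
have cw0 := coupling_weight_gt0.
have th0 : 0 <= 1 - (1 - kappa) / (2 * n).
  by rewrite subr_ge0 ler_pdivrMr ?mulr_gt0//; lra.
have D0 : 0 <= drift_const q beta kappa.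
  by rewrite addr_ge0// divr_ge0 ?sqr_ge0// mulr_ge0//; lra.
have floor0 : 0 <= coupling_floor.
  have g0 : 0 <= 1 - kappa by lra.
  apply: divr_ge0; last exact: ltW.
  by apply: divr_ge0 => //; rewrite mulr_ge0// mulr_ge0// ltW.
have dist_ge (b c : state) : (b != c)%:R <= coupled_dist b c.
  apply: le_trans (_ : hamming (val b) (val c) <= _).
    by rewrite -val_eqE; apply: hamming_neq.
  rewrite lerDl; apply: mulr_ge0; last by rewrite addr_ge0 ?sqr_ge0.
  by apply: mulr_ge0; apply: ltW.
have dist_le (b c : state) : coupled_dist b c <= n + 2 * coupling_weight * n.
  have sq1 (e : state) : sqdist x (val e) ^+ 2 <= 1.
    rewrite expr_le1 ?sqdist_ge0//; apply: le_trans (sqdist_state e) _.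
    by rewrite expr_le1// ltW.
  apply: lerD; first exact: hamming_le.
  have -> : 2 * coupling_weight * n = coupling_weight * n * (1 + 1) by ring.
  rewrite ler_pM2l; first exact: lerD.
  exact: mulr_gt0.
apply: tv_dist_stationary.
- rewrite addr_ge0// mulr_ge0 ?exprn_ge0//.
  exact: le_trans (ler0n _ _) (le_trans (dist_ge a a) (dist_le a a)).
- exact: gibbs_ball_ge0.
- exact: gibbs_ball_sum a.
- by move=> b; apply: gibbs_ball_stationary.
move=> b A.
apply: le_trans (kernel_iter_contract th0 dist_ge glauber_coupling T A a b) _.
rewrite lerD2r ler_wpM2l ?exprn_ge0//.
by have := dist_le a b; lra.
Qed.

End RestrictedCoupling.

(** The initial distance is of order [n], so a decay by [1 / n^2] leaves [O(1 / n)], the order of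
    the floor. The factor [4 / g] makes the exponent [t g / (2 n)] reach [2 ln n]. *)
Lemma mixing_bound_large (R : realType) (A F g n : R) (th : R) (t : nat) :
  0 <= A -> 0 < g -> 2 <= n -> 0 <= th <= expR (- (g / (2 * n))) ->
  4 * (1 + 2 * A + F) <= n -> 4 / g * (n * ln n) <= t%:R ->
  th ^+ t * (n + 2 * A * n) + F / n <= 1 / 4.
Proof.
move=> A0 g0 n2 /andP[th0 thE] hn ht.
have n0 : 0 < n by lra.
have hth : th ^+ t <= (n ^+ 2)^-1.
  apply: (@le_trans _ _ (expR (- (g / (2 * n))) ^+ t)).
    by rewrite lerXn2r ?nnegrE ?expR_ge0.
  rewrite -expRM_natl -[leRHS]lnK ?posrE ?invr_gt0 ?exprn_gt0// ler_expR.
  rewrite lnV ?posrE ?exprn_gt0// lnXn// mulrN lerN2 -[ln n *+ 2]mulr_natr.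
  apply: (@le_trans _ _ (4 / g * (n * ln n) * (g / (2 * n)))).
    by rewrite le_eqVlt; apply/orP; left; apply/eqP; field; rewrite !gt_eqF.
  by apply: ler_wpM2r => //; apply: divr_ge0; [exact: ltW | rewrite mulr_ge0// ltW].
apply: (@le_trans _ _ ((n ^+ 2)^-1 * (n + 2 * A * n) + F / n)).
  by rewrite lerD2r ler_wpM2r// addr_ge0 ?mulr_ge0// ltW.
have -> : (n ^+ 2)^-1 * (n + 2 * A * n) + F / n = (1 + 2 * A + F) / n.
  by field; rewrite gt_eqF.
by rewrite ler_pdivrMr//; lra.
Qed.

Theorem theorem1p5 (R : realType) (q : nat) (hq : (3 <= q)%N) (beta : R)
    (hbeta : spinodal q <= beta) :
  exists2 r0 : R, 0 < r0 &
    forall r : R, 0 < r <= r0 ->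
    forall x : 'rV[R]_q, macrostates beta x ->
    exists2 C : R, 0 < C &
      exists N0 : nat, forall N : nat, (N0 <= N)%N ->
        (t_mix N beta x r (1 / 4) <= (C * (N%:R * ln N%:R))%:E)%E.
Proof.
have beta0 : 0 < beta by apply: lt_le_trans hbeta; apply: spinodal_gt0.
have q0 : (0 < q)%N by apply: leq_trans hq.
have [kappa [r1 [kappa01 r10 H]]] := local_contraction hq beta0.
(* [r <= r1] keeps the ball inside the region of [local_contraction]; [r <= 1] bounds [sqdist] by 1,
   hence [coupled_dist] by a multiple of [n]. *)
exists (Num.min r1 1); first by rewrite lt_min r10 ltr01.
move=> r /andP[r0]; rewrite le_min => /andP[rr1 rle1] x /H[_ lip drift].
have [k0 k1] := andP kappa01.
pose g := 1 - kappa; have g0 : 0 < g by rewrite subr_gt0.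
pose A := coupling_weight r kappa; have A0 : 0 < A by apply: coupling_weight_gt0.
pose F := 4 * A * drift_const q beta kappa / g.
(* The extra 1 absorbs rounding the time up to an integer, as [n ln n >= 1]. *)
exists (4 / g + 1); first by rewrite addr_gt0 ?divr_gt0.
pose M := 8 * beta + 4 / r + `|4 * (1 + 2 * A + F)| + 2.
exists (Num.truncn M).+1 => N N0.
have nM : M <= N%:R.
  by apply: (le_trans (ltW (truncnS_gt M))); rewrite ler_nat.
set n : R := N%:R in nM *.
have r40 : 0 < 4 / r by rewrite divr_gt0.
have F_le := ler_norm (4 * (1 + 2 * A + F)).
have abs0 := normr_ge0 (4 * (1 + 2 * A + F)).
have n2 : 2 <= n by rewrite /M in nM; lra.
have n0 : 0 < n by lra.
have Nb : 8 * beta <= n by rewrite /M in nM; lra.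
have Nr : 4 <= n * r by rewrite -ler_pdivrMr//; rewrite /M in nM; lra.
have NF : 4 * (1 + 2 * A + F) <= n by rewrite /M in nM; lra.
have nln : 1 <= n * ln n.
  have : - ln n <= n^-1 - 1 by rewrite -lnV ?posrE//; apply: ln_le_subr1; rewrite invr_gt0.
  have -> : n^-1 - 1 = - ((n - 1) / n) by field; rewrite gt_eqF.
  rewrite lerN2 -(ler_pM2l n0) mulrC divfK ?gt_eqF//; lra.
pose T := (Num.truncn (4 / g * (n * ln n))).+1.
have T0 : 0 <= 4 / g * (n * ln n) by rewrite mulr_ge0 ?divr_ge0//; lra.
have /andP[T1 T2] := truncn_itv T0.
apply: (@le_trans _ _ T%:R%:E).
  apply: mixing_time_le; first lra.
  move=> a.
  have Npos : (0 < N)%N by apply: leq_ltn_trans N0.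
  apply: le_trans (tv_dist_bound q0 Npos r0 rle1 rr1 beta0 kappa01 lip drift Nb Nr T a) _.
  apply: (@mixing_bound_large R A F g n) => //.
  - exact: ltW.
  - apply/andP; split; last exact: expR_ge1Dx.
    by rewrite subr_ge0 ler_pdivrMr ?mulr_gt0//; rewrite /g in g0 *; lra.
  - exact: ltW.
rewrite lee_fin /T -natr1.
by lra.
Qed.
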